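(* Let $\Omega\subset\mathbb{R}^2$ be a bounded open set and, for $i=1,2$, let $\mathcal{P}_i$ be the first-order differential operator acting on $\varphi\in C_c^\infty(\Omega,\mathbb{R}^2)$ by $\mathcal{P}_i\varphi=P_i(\mathrm{D}\varphi)$, where $P_i\colon\mathbb{R}^{2\times 2}\to\mathbb{R}^{d_i}$ is a linear map. Suppose that there is a constant $C$ such that $$\Vert\mathcal{P}_1\varphi\Vert_{L^1}\leq C\,\Vert\mathcal{P}_2\varphi\Vert_{L^1}\qquad\text{for all }\varphi\in C_c^\infty(\Omega,\mathbb{R}^2).$$ Then there is a linear map $T\colon\mathbb{R}^{d_2}\to\mathbb{R}^{d_1}$ such that $P_1=T\circ P_2$. Moreover, the same conclusion (there is a linear map $T\colon\mathbb{R}^{d_2}\to\mathbb{R}^{d_1}$ such that $P_1=T\circ P_2$) is true if the inequality $\Vert\mathcal{P}_1\varphi\Vert_{L^1}\leq C\,\Vert\mathcal{P}_2\varphi\Vert_{L^1}$ is required to hold only for those $\varphi$ of the form $\varphi=\nabla\phi$ for some $\phi\in C_c^\infty(\Omega,\mathbb{R})$.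
   Context: $\mathbb{R}^{2\times 2}$ is the space of real $2\times 2$ matrices. $C_c^\infty(\Omega,\mathbb{R}^m)$ denotes the smooth functions with compact support in $\Omega$ and values in $\mathbb{R}^m$; $\mathrm{D}\varphi(x)\in\mathbb{R}^{2\times 2}$ is the Jacobian matrix of $\varphi$ at $x$, and $\nabla\phi$ is the gradient of the scalar function $\phi$. The norm is $\Vert g\Vert_{L^1}=\int_\Omega|g(x)|\,\mathrm{d}x$, with $|\cdot|$ the Euclidean norm on $\mathbb{R}^{d_i}$.
   Formalization: Ω is assumed nonempty (the claim fails for empty Ω), and in the ''Moreover'' part P₁ = T∘P₂ is asserted only on symmetric matrices, since on all of ℝ^{2×2} it is false: take P₁(A) = A₁₂ − A₂₁ and P₂ = 0, for which P₁(D∇φ) = 0. *)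

(* Defs.v *)
From mathcomp Require Import all_boot all_order all_algebra.
From mathcomp Require Import all_classical all_reals all_analysis.

Set Implicit Arguments.
Unset Strict Implicit.
Unset Printing Implicit Defensive.

Import Order.TTheory GRing.Theory Num.Theory.
Import numFieldNormedType.Exports.

Local Open Scope classical_set_scope.
Local Open Scope ring_scope.

(* Points of the plane live in [R * R], which carries the product Lebesgue
   measure; vectors and matrices use the matrix library. *)

Definition basis2 {R : realType} (j : 'I_2) : R * R :=
  if j == ord0 then (1, 0) else (0, 1).

Definition partial {R : realType} {W : normedModType R} (j : 'I_2)
    (f : R * R -> W) : R * R -> W :=
  fun x => 'D_(basis2 j) f x.

(* A list of indices encodes an iterated partial derivative; its last entry is
   the first variable differentiated. *)
Definition iter_partial {R : realType} {W : normedModType R} (s : seq 'I_2)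
    (f : R * R -> W) : R * R -> W :=
  foldr partial f s.

Definition smooth {R : realType} {W : normedModType R} (f : R * R -> W) : Prop :=
  forall s : seq 'I_2,
    continuous (iter_partial s f) /\
    forall (j : 'I_2) (x : R * R), derivable (iter_partial s f) x (basis2 j).

(* [C_c^infty(Omega, W)]: since the support is a compact subset of [Omega],
   these functions are identified with their extensions by zero to the plane. *)
Definition Cc_infty {R : realType} {W : normedModType R} (Omega : set (R * R))
    (f : R * R -> W) : Prop :=
  let supp := closure [set x | f x != 0] in
  [/\ smooth f, compact supp & supp `<=` Omega].

(* Row [i], column [j] holds the [j]-th partial derivative of the [i]-th
   component; the library's [jacobian] is the transpose of this matrix. *)
Definition Jac {R : realType} (phi : R * R -> 'rV[R]_2) (x : R * R) : 'M[R]_2 :=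
  \matrix_(i < 2, j < 2) (partial j phi x) ord0 i.

Definition grad {R : realType} (u : R * R -> R) (x : R * R) : 'rV[R]_2 :=
  \row_(j < 2) partial j u x.

(* The library's norm on matrices is the sup norm. *)
Definition euclid_norm {R : realType} {d : nat} (v : 'rV[R]_d) : R :=
  Num.sqrt (\sum_(i < d) v ord0 i ^+ 2).

Definition L1norm {R : realType} {d : nat} (Omega : set (R * R))
    (g : R * R -> 'rV[R]_d) : \bar R :=
  (\int[(@lebesgue_measure R \x @lebesgue_measure R)%E]_(x in Omega)
     (euclid_norm (g x))%:E)%E.

Definition first_order_op {R : realType} {d : nat}
    (P : {linear 'M[R]_2 -> 'rV[R]_d}) (phi : R * R -> 'rV[R]_2) :
    R * R -> 'rV[R]_d :=
  fun x => P (Jac phi x).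

(* Main.v *)
(** Both parts reduce to showing that [P2 S = 0] forces [P1 S = 0] for symmetric
    [S]; the first one uses the fields [A grad u], whose Jacobian is [A] times the
    Hessian of [u], with [S = 1].

    Write [S = A + B] with [A = a v v^T] and [B = b w w^T], and set [D = A - B].
    Let [s_k = sin (N_k v_k . x)] with [v_k] alternating between [v] and [w] and [N_k]
    growing so fast that the [s_k] behave like independent variables. The Riesz
    product [M = prod (1 + s_k)] is bounded in [L^1], but its martingale transform
    [F = sum_k (-1)^k M_(k-1) s_k] is not. A function [u] supported in a fixed
    compact set, with Hessian close to [chi (F/2 S + (M - 1)/2 D)], is obtained by adding
    multiples of [N_k^-2 chi M_(k-1) s_k]. Since [P2] kills [S], it does not see [F],
    whereas [P1] does unless [P1 S = 0].

    The lower bound on the norm of [F] comes from pairing with the imaginary part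
    of [R = prod (1 + i (-1)^k lam s_k)]: with [lam = 1/n] and [2 n^2] factors, [R] stays
    bounded while the integral of [F Im R] is at least [n]. *)

Require Import Defs.
From HB Require Import structures.
From mathcomp Require Import all_boot all_order all_algebra.
From mathcomp Require Import all_classical all_reals all_analysis.
From mathcomp Require Import ring lra.
Import Order.TTheory GRing.Theory Num.Theory.
Import numFieldNormedType.Exports.
Local Open Scope classical_set_scope.
Local Open Scope ring_scope.

(** * Smooth functions on the plane *)

(** By induction on the list of indices. In each use [K] collects the functions of the shape that
    iterated partials of [f] can take, so that no formula for higher derivatives is needed. *)
Lemma smooth_class {R : realType} {W : normedModType R}
    (K : (R * R -> W) -> Prop) (f : R * R -> W) :
  (forall g, K g -> continuous g /\ forall j x, derivable g x (basis2 j)) ->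
  (forall g j, K g -> K (partial j g)) -> K f -> smooth f.
Proof.
move=> Kreg Kpartial Kf s.
have Ks : K (iter_partial s f) by elim: s => [//|j s IH] /=; exact: Kpartial.
by have [c d] := Kreg _ Ks; split.
Qed.

(** The last index of a list is differentiated first, so iterated partials of [partial j f] are
    those of [f] with [j] appended. *)
Lemma smooth_partial {R : realType} {W : normedModType R} {f : R * R -> W} j :
  smooth f -> smooth (partial j f).
Proof. by move=> sf s; have := sf (rcons s j); rewrite /iter_partial foldr_rcons. Qed.

Lemma smooth_continuous {R : realType} {W : normedModType R} {f : R * R -> W} :
  smooth f -> continuous f.
Proof. by move=> /(_ [::]) []. Qed.

Lemma smooth_derivable {R : realType} {W : normedModType R} {f : R * R -> W} :
  smooth f -> forall j x, derivable f x (basis2 j).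
Proof. by move=> /(_ [::]) []. Qed.

Lemma smooth_cst {R : realType} {W : normedModType R} (c : W) :
  smooth (fun _ : R * R => c).
Proof.
apply: (@smooth_class _ _ (fun f => exists c, f = cst c)); last by exists c.
  by move=> _ [k ->]; split=> *; [exact: cst_continuous|exact: derivable_cst].
move=> _ j [k ->]; exists 0; apply/funext => x.
by rewrite /partial derive_cst.
Qed.

Lemma partialD {R : realType} {W : normedModType R} (f g : R * R -> W) j :
  smooth f -> smooth g ->
  partial j (fun x => f x + g x) = (fun x => partial j f x + partial j g x).
Proof.
move=> sf sg; apply/funext => x.
exact: deriveD (smooth_derivable sf _ _) (smooth_derivable sg _ _).
Qed.

Lemma smoothD {R : realType} {W : normedModType R} (f g : R * R -> W) :
  smooth f -> smooth g -> smooth (fun x => f x + g x).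
Proof.
move=> sf sg.
apply: (@smooth_class _ _ (fun h => exists f g,
  [/\ smooth f, smooth g & h = (fun x => f x + g x)])); last by exists f, g.
  move=> _ [f' [g' [sf' sg' ->]]]; split=> [x|j x].
    by apply: continuousD; exact: smooth_continuous.
  exact: derivableD (smooth_derivable sf' _ _) (smooth_derivable sg' _ _).
move=> _ j [f' [g' [sf' sg' ->]]].
by exists (partial j f'), (partial j g'); split; rewrite ?partialD//; exact: smooth_partial.
Qed.

Lemma partialM {R : realType} (f g : R * R -> R) j :
  smooth f -> smooth g ->
  partial j (fun x => f x * g x) =
  (fun x => partial j f x * g x + f x * partial j g x).
Proof.
move=> sf sg; apply/funext => x.
rewrite addrC (mulrC (partial j f x)).
exact: deriveM (smooth_derivable sf _ _) (smooth_derivable sg _ _).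
Qed.

(* Unlike single products, these sums are closed under partial derivatives. *)
Inductive sum_of_products {R : realType} : (R * R -> R) -> Prop :=
| SumOfProducts1 (f g : R * R -> R) : smooth f -> smooth g ->
    sum_of_products (fun x => f x * g x)
| SumOfProductsD f g : sum_of_products f -> sum_of_products g ->
    sum_of_products (fun x => f x + g x).

Lemma smoothM {R : realType} (f g : R * R -> R) :
  smooth f -> smooth g -> smooth (fun x => f x * g x).
Proof.
move=> sf sg.
have reg (h : R * R -> R) : sum_of_products h ->
    continuous h /\ forall j x, derivable h x (basis2 j).
  elim=> [h1 h2 s1 s2|h1 h2 _ [c1 d1] _ [c2 d2]]; split=> [x|j x].
  - exact: (cvgM (smooth_continuous s1 x) (smooth_continuous s2 x)).
  - exact: derivableM (smooth_derivable s1 _ _) (smooth_derivable s2 _ _).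
  - exact: (cvgD (c1 x) (c2 x)).
  - exact: derivableD (d1 _ _) (d2 _ _).
apply: (@smooth_class _ _ sum_of_products); [exact: reg| |exact: (SumOfProducts1 _ _ sf sg)].
move=> h j; elim=> [h1 h2 s1 s2|h1 h2 k1 IH1 k2 IH2].
  rewrite (partialM _ _ _ s1 s2).
  apply: SumOfProductsD; apply: SumOfProducts1;
    [exact: smooth_partial|exact: s2|exact: s1|exact: smooth_partial].
have -> : partial j (fun x => h1 x + h2 x) =
    (fun x => partial j h1 x + partial j h2 x).
  by apply/funext => x; exact: deriveD ((reg _ k1).2 _ _) ((reg _ k2).2 _ _).
exact: SumOfProductsD.
Qed.

Lemma smoothZ {R : realType} (c : R) (f : R * R -> R) :
  smooth f -> smooth (fun x => c * f x).
Proof. by move=> sf; exact: smoothM (smooth_cst c) sf. Qed.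

Lemma partialZ {R : realType} (c : R) (f : R * R -> R) j :
  smooth f -> partial j (fun x => c * f x) = (fun x => c * partial j f x).
Proof.
by move=> sf; apply/funext => x; exact: deriveZ (smooth_derivable sf _ _).
Qed.

(** The whole sequence of derivatives serves as the witness, which lets concrete functions supply
    theirs in closed form. *)
Definition smooth1 {R : realType} (g : R -> R) : Prop :=
  exists2 G : nat -> R -> R, G 0%N = g &
    forall n (x : R), is_derive x (1 : R) (G n) (G n.+1 x).

Definition affine {R : realType} (v : 'I_2 -> R) (c : R) (x : R * R) : R :=
  v ord0 * x.1 + v ord_max * x.2 + c.

Lemma affine_basis2 {R : realType} (v : 'I_2 -> R) c j h x :
  affine v c (h *: basis2 j + x) = h *: v j + affine v c x.
Proof.
rewrite /affine /basis2; case: eqP => [->|/eqP j0] /=.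
  by rewrite /GRing.scale/=; ring.
have -> : j = ord_max by apply: val_inj; move: j j0; case; case=> [|[|]].
by rewrite /GRing.scale/=; ring.
Qed.

Lemma continuous_affine {R : realType} (v : 'I_2 -> R) c : continuous (affine v c).
Proof.
move=> x; apply: cvgD; last exact: cvg_cst.
by apply: cvgD; apply: cvgMr; [exact: cvg_fst|exact: cvg_snd].
Qed.

(** A shift by [h] along [basis2 j] moves the argument of [g] by [h v_j], so the difference
    quotients are literally those of [g] in the direction [v j], and linearity of the differential
    on the line gives the factor. *)
Lemma is_derive_affine_comp {R : realType} (g : R -> R) (dg : R) v c j x :
  is_derive (affine v c x) (1 : R) g dg ->
  is_derive x (basis2 j) (g \o affine v c) (v j * dg).
Proof.
move=> [gd gE].
have dg1 : differentiable g (affine v c x) by apply/derivable1_diffP.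
have gv : is_derive (affine v c x) (v j) g (v j * dg).
  split; first exact: diff_derivable.
  rewrite -gE !deriveE// -[X in 'd _ _ X = _]mulr1.
  by rewrite [LHS]linearZ.
have E : (fun h => h^-1 *: ((g \o affine v c) (h *: basis2 j + x) - (g \o affine v c) x))
  = (fun h => h^-1 *: (g (h *: v j + affine v c x) - g (affine v c x))).
  by apply/funext => h; rewrite /= affine_basis2.
by case: gv => gv1 gv2; split; rewrite ?/derivable ?/derive E.
Qed.

Lemma is_derive1_continuous {R : realType} (g : R -> R) (x dg : R) :
  is_derive x (1 : R) g dg -> {for x, continuous g}.
Proof. by move=> [gd _]; exact/differentiable_continuous/derivable1_diffP. Qed.

Lemma continuous_affine_comp {R : realType} (g : R -> R) (v : 'I_2 -> R) c :
  continuous g -> continuous (g \o affine v c).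
Proof.
by move=> gc x; apply: continuous_comp; [exact: continuous_affine|exact: gc].
Qed.

Lemma smooth_affine_comp {R : realType} (g : R -> R) v c :
  smooth1 g -> smooth (g \o affine v c).
Proof.
move=> [G G0 dG].
pose K (f : R * R -> R) := exists a n, f = (fun x => a * G n (affine v c x)).
have dK a n j x : is_derive x (basis2 j) (fun x => a * G n (affine v c x))
    (a * (v j * G n.+1 (affine v c x))).
  have [d dE] := is_derive_affine_comp (G n) _ v c j x (dG n _).
  by split; [exact: derivableZ|rewrite -dE; exact: deriveZ].
apply: (@smooth_class _ _ K); last first.
- by exists 1, 0%N; apply/funext => x; rewrite mul1r G0.
- move=> _ j [a [n ->]]; exists (a * v j), n.+1; apply/funext => x.
  by rewrite /partial (@derive_val _ _ _ _ _ _ _ (dK a n j x)) mulrA.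
- move=> _ [a [n ->]]; split=> [x|j x]; last by have [] := dK a n j x.
  apply: cvgMr; apply: continuous_affine_comp => t.
  exact: is_derive1_continuous (dG n t).
Qed.

Lemma partial_affine_comp {R : realType} (g g' : R -> R) v c j :
  (forall x : R, is_derive x (1 : R) g (g' x)) ->
  partial j (g \o affine v c) = (fun x => v j * g' (affine v c x)).
Proof.
move=> dg; apply/funext => x; rewrite /partial.
exact: (@derive_val _ _ _ _ _ _ _ (is_derive_affine_comp _ _ _ _ _ _ (dg _))).
Qed.

(** Differentiation shifts the argument by [pi / 2], which gives all derivatives in one formula. *)
Lemma smooth1_sin {R : realType} : smooth1 (@sin R).
Proof.
exists (fun n x => sin (x + pi / 2 *+ n)).
  by apply/funext => x; rewrite mulr0n addr0.
move=> n x.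
have -> : sin (x + pi / 2 *+ n.+1) = cos (x + pi / 2 *+ n).
  by rewrite mulrSr addrA sinDpihalf.
by apply: is_derive_eq; rewrite addr0; exact: mulr1.
Qed.

Lemma smooth1_cos {R : realType} : smooth1 (@cos R).
Proof.
exists (fun n x => sin (x + pi / 2 *+ n.+1)).
  by apply/funext => x; rewrite mulr1n sinDpihalf.
move=> n x.
have -> : sin (x + pi / 2 *+ n.+2) = cos (x + pi / 2 *+ n.+1).
  by rewrite mulrSr addrA sinDpihalf.
by apply: is_derive_eq; rewrite addr0; exact: mulr1.
Qed.

(** * A flat function on the line *)

(** The difference quotient at [0] is at most [C |h|]. This settles the point where the two branches
    of a flat function meet. *)
Lemma is_derive_quadratic_bound {R : realType} (f : R -> R) (C : R) :
  (forall h, `|f h| <= C * h ^+ 2) -> is_derive (0 : R) (1 : R) f 0.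
Proof.
move=> fC.
have f0 : f 0 = 0.
  by apply/eqP; rewrite -normr_le0 (le_trans (fC 0))// expr0n mulr0.
have H : h^-1 *: (f (h *: (1 : R) + 0) - f 0) @[h --> 0^'] --> (0 : R).
  apply/cvgr0Pnorm_lt => e e0; near=> h.
  have h0 : h != 0 by near: h; exact: nbhs_dnbhs_neq.
  have hC : `|h| < e / (`|C| + 1).
    near: h; apply: dnbhs0_lt; apply: divr_gt0 => //.
  rewrite f0 subr0 addr0 scaler1 normrZ normfV.
  rewrite mulrC ltr_pdivrMr ?normr_gt0//.
  apply: (le_lt_trans (fC h)).
  rewrite -real_normK ?num_real// expr2 mulrA ltr_pM2r ?normr_gt0//.
  rewrite ltr_pdivlMr in hC; last by rewrite ltr_pwDr.
  apply: le_lt_trans hC.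
  rewrite mulrC ler_wpM2l// (le_trans (ler_norm _))// lerDl.
  exact: ler01.
by split; [exact: cvgP H|exact: cvg_lim H].
Unshelve. all: by end_near. Qed.

(** Term by term from [y^n <= n! e^y], which comes from the exponential series. *)
Lemma horner_le_expR {R : realType} (p : {poly R}) :
  exists C : R, forall y, 0 <= y -> `|p.[y]| <= C * expR y.
Proof.
exists (\sum_(i < size p) `|p`_i| * i`!%:R) => y y0.
rewrite horner_coef (le_trans (ler_norm_sum _ _ _))// mulr_suml ler_sum// => i _.
rewrite normrM -mulrA ler_wpM2l// ger0_norm ?exprn_ge0//.
case: (i : nat) => [|n].
  by rewrite expr0 mul1r (le_trans _ (expR_ge1Dx y))// lerDl.
have := expR_ge1Dxn n y0.
set a := y ^+ _; set b := _`!%:R => H.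
have b0 : 0 < b by rewrite ltr0n fact_gt0.
rewrite mulrC -ler_pdivrMr//.
by apply: le_trans H; rewrite lerDr ler01.
Qed.

(* The factor [p.[x^-1]] makes the class closed under differentiation. *)
Definition flat_exp {R : realType} (p : {poly R}) (x : R) : R :=
  if 0 < x then p.[x^-1] * expR (- x^-1) else 0.

(** With [y = 1/x] one has [d/dx = - y^2 d/dy], which sends [p(y) e^-y] to [y^2 (p - p')(y) e^-y].
    Only the origin needs an estimate. *)
Lemma is_derive_flat_exp {R : realType} (p : {poly R}) (x : R) :
  is_derive x (1 : R) (flat_exp p) (flat_exp ('X^2 * (p - p^`())) x).
Proof.
have [x0|x0|<-] := ltgtP 0 x.
- have d : is_derive x (1 : R) (fun x : R => p.[x^-1] * expR (- x^-1))
      (flat_exp ('X^2 * (p - p^`())) x).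
    have xn0 : id x != 0 by rewrite gt_eqF.
    have dV := is_deriveV xn0 (is_derive_id x (1 : R)).
    have d1 := is_derive1_comp (is_derive_poly p x^-1) dV.
    have d2 := @is_derive1_comp _ expR (fun x => - x^-1) _ _ _
      (is_derive_expR (- x^-1)) (is_deriveN dV).
    apply: (is_derive_eq (is_deriveM d1 d2)).
    rewrite /flat_exp x0 !hornerE /= /GRing.scale/=.
    have -> : x ^- 2 = x^-1 ^+ 2 by rewrite exprVn.
    by ring.
  case: d => d dE; have E : {near x, (fun x : R => p.[x^-1] * expR (- x^-1)) =1 flat_exp p}.
    near=> y; rewrite /flat_exp; have -> // : 0 < y.
    by near: y; exact: lt_nbhsr.
  split; first exact: near_eq_derivable E d.
  by rewrite -dE; apply/esym; exact: near_eq_derive.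
- have E : {near x, cst 0 =1 flat_exp p}.
    near=> y; rewrite /flat_exp ltNge.
    have -> // : y <= 0.
    by apply: ltW; near: y; exact: lt_nbhsl.
  split; first exact: near_eq_derivable E (derivable_cst _ _ _).
  rewrite -(near_eq_derive (1 : R) E) derive_cst.
  by rewrite /flat_exp ltNge (ltW x0).
- rewrite [X in is_derive _ _ _ X]/flat_exp ltxx.
  (* The extra factor ['X^2] turns the exponential bound into [|flat_exp p h| <= C h^2]. *)
  have [C HC] := horner_le_expR ('X^2 * p).
  apply: (@is_derive_quadratic_bound _ _ C) => h.
  have C0 : 0 <= C.
    have := HC 0 (lexx _); rewrite expR0 mulr1; exact: le_trans.
  rewrite /flat_exp; case: ifPn => [h0|_]; last by rewrite normr0 mulr_ge0 ?sqr_ge0.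
  have hV : 0 <= h^-1 by rewrite invr_ge0 ltW.
  have H : h ^- 2 * `|p.[h^-1]| <= C * expR h^-1.
    by have := HC _ hV; rewrite !hornerE normrM ger0_norm ?exprn_ge0// exprVn.
  rewrite normrM (ger0_norm (expR_ge0 _)) expRN ler_pdivrMr ?expR_gt0//.
  rewrite (mulrAC C) -ler_pdivrMr ?exprn_gt0//.
  by rewrite mulrC.
Unshelve. all: by end_near. Qed.

Lemma smooth1_flat_exp {R : realType} (p : {poly R}) : smooth1 (flat_exp p).
Proof.
exists (fun n => flat_exp (iter n (fun p => 'X^2 * (p - p^`())) p)) => //.
by move=> n x; exact: is_derive_flat_exp.
Qed.

(** * Compactly supported smooth functions *)

(** Vanishing off a fixed [K] passes to products and, when [K] is closed, to partial derivatives,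
    without any closure of a nonvanishing set to keep track of. *)
Definition supported {R : realType} {W : normedModType R} (K : set (R * R))
    (f : R * R -> W) : Prop := forall x, ~ K x -> f x = 0.

Lemma supported_partial {R : realType} {W : normedModType R} (K : set (R * R))
    (f : R * R -> W) j :
  closed K -> supported K f -> supported K (partial j f).
Proof.
move=> cK sf x Kx; rewrite /partial -(derive_cst 0 x (basis2 j)).
apply: near_eq_derive.
have : \near x, (~` K) x by apply: open_nbhs_nbhs; split => //; exact: closed_openC.
by apply: filterS => y Ky; rewrite sf.
Qed.

Lemma compact_closed_plane {R : realType} {K : set (R * R)} : compact K -> closed K.
Proof. by move=> cK; apply: compact_closed cK; exact: norm_hausdorff. Qed.

Lemma Cc_infty_supported {R : realType} {W : normedModType R}
    (Omega K : set (R * R)) (f : R * R -> W) :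
  compact K -> K `<=` Omega -> supported K f -> smooth f -> Cc_infty Omega f.
Proof.
move=> cK KO sK sf.
have cK' := compact_closed_plane cK.
have sub : closure [set x | f x != 0] `<=` K.
  rewrite closure_id in cK'; rewrite [K in _ `<=` K]cK'.
  apply: closure_subset => x /= fx; apply: contrapT => /sK fx0.
  by rewrite fx0 eqxx in fx.
split=> //; last exact: subset_trans KO.
exact: subclosed_compact (@closed_closure _ _) cK sub.
Qed.

Lemma exists_bump {R : realType} (Omega : set (R * R)) :
  open Omega -> Omega !=set0 ->
  exists K (chi : R * R -> R) p,
    [/\ compact K, K `<=` Omega, supported K chi, smooth chi
      & (forall x, 0 <= chi x) /\ 0 < chi p].
Proof.
move=> oO [p Op].
have /nbhs_ballP[e /= e0 eO] : nbhs p Omega by exact: open_nbhs_nbhs.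
pose r := e / 2; have r0 : 0 < r by rewrite divr_gt0.
pose flat := @flat_exp R 1.
have flat_ge0 x : 0 <= flat x.
  by rewrite /flat /flat_exp; case: ifP => // _; rewrite hornerC mul1r expR_ge0.
have flat_gt0 x : 0 < x -> 0 < flat x.
  by move=> x0; rewrite /flat /flat_exp x0 hornerC mul1r expR_gt0.
have flat0 x : x <= 0 -> flat x = 0 by rewrite /flat /flat_exp ltNge => ->.
pose e1 (j : 'I_2) : R := (j == ord0)%:R.
pose e2 (j : 'I_2) : R := (j == ord_max)%:R.
(* Four flat factors, one for each side of the square [K] of half-width [r] about [p]; taking
   [r = e / 2] keeps the closed square inside the ball of radius [e]. *)
pose chi x := (flat \o affine e1 (r - p.1)) x *
              (flat \o affine (fun j => - e1 j) (r + p.1)) x *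
              ((flat \o affine e2 (r - p.2)) x *
               (flat \o affine (fun j => - e2 j) (r + p.2)) x).
pose K := (`[p.1 - r, p.1 + r]%classic `*` `[p.2 - r, p.2 + r]%classic) : set (R * R).
have chiE x : chi x = flat (x.1 - (p.1 - r)) * flat (p.1 + r - x.1) *
    (flat (x.2 - (p.2 - r)) * flat (p.2 + r - x.2)).
  rewrite /chi /= /affine /e1 /e2 /=.
  by congr (_ * _ * (_ * _)); congr (flat _); ring.
exists K, chi, p; split.
- by apply: compact_setX; exact: segment_compact.
- move=> x [/=]; rewrite !in_itv/= => /andP[x1 x2] /andP[x3 x4].
  apply: eO; split; rewrite /ball/= ltr_norml; apply/andP; split;
    move: e0 x1 x2 x3 x4; rewrite /r; lra.
- move=> x Kx; rewrite chiE.
  have [a|a] := leP x.1 (p.1 - r); first by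
    rewrite [flat (x.1 - _)]flat0 ?subr_le0// !mul0r.
  have [b|b] := leP (p.1 + r) x.1; first by
    rewrite [flat (_ - x.1)]flat0 ?subr_le0// mulr0 !mul0r.
  have [c|c] := leP x.2 (p.2 - r); first by
    rewrite [flat (x.2 - _)]flat0 ?subr_le0// mul0r !mulr0.
  have [d|d] := leP (p.2 + r) x.2; first by
    rewrite [flat (_ - x.2)]flat0 ?subr_le0// !mulr0.
  by exfalso; apply: Kx; split; rewrite /= in_itv/= !ltW.
- by do 2?apply: smoothM; apply: smooth_affine_comp; exact: smooth1_flat_exp.
- split; first by move=> x; rewrite chiE !mulr_ge0.
  by rewrite chiE !mulr_gt0//; apply: flat_gt0; move: r0; lra.
Qed.

Lemma smooth_rV {R : realType} n (f : R * R -> 'rV[R]_n.+1) :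
  (forall i, smooth (fun x => f x ord0 i)) -> smooth f.
Proof.
move=> sf.
have d (g : R * R -> 'rV[R]_n.+1) (sg : forall i, smooth (fun x => g x ord0 i)) j x :
    derivable g x (basis2 j).
  by apply/derivable_mxP => i k; rewrite ord1; exact: smooth_derivable.
apply: (@smooth_class _ _ (fun g : R * R -> 'rV[R]_n.+1 =>
  forall i, smooth (fun x => g x ord0 i))); last exact: sf.
- move=> g sg; split; last exact: d.
  have -> : g = (fun x => \sum_i g x ord0 i *: delta_mx ord0 i).
    by apply/funext => x; rewrite -row_sum_delta.
  apply: continuous_big => [|i _ x]; first exact: add_continuous.
  by apply: cvgZr_tmp; exact: smooth_continuous.
- move=> g j sg i.
  have -> : (fun x => partial j g x ord0 i) = partial j (fun x => g x ord0 i).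
    by apply/funext => x; rewrite /partial derive_mx ?mxE//; exact: d.
  exact: smooth_partial.
Qed.

Lemma partial_coord {R : realType} n (f : R * R -> 'rV[R]_n.+1) i j x :
  smooth f -> partial j f x ord0 i = partial j (fun y => f y ord0 i) x.
Proof. by move=> sf; rewrite /partial derive_mx ?mxE//; exact: smooth_derivable. Qed.

(** * Integration over the plane *)

(** An open set is a countable union of boxes with rational corners, and boxes are measurable for
    the product structure. *)
Lemma open_measurable_plane {R : realType} (A : set (R * R)) :
  open A -> measurable (A : set (measurableTypeR R * measurableTypeR R)).
Proof.
move=> oA.
pose box (q : rat * rat * (rat * rat)) : set (R * R) :=
  `]ratr q.1.1, ratr q.1.2[%classic `*` `]ratr q.2.1, ratr q.2.2[%classic.
(* Boxes that leave [A] are replaced by the empty set, so that the union runs over a whole countable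
   type. *)
pose B q := if asbool (box q `<=` A) then box q else set0.
have -> : A = \bigcup_q B q.
  apply/seteqP; split=> [x Ax|x [q _]]; last first.
    by rewrite /B; case: asboolP => // qA; exact: qA.
  have /nbhs_ballP[e /= e0 eA] : nbhs x A by exact: open_nbhs_nbhs.
  have rat_near (t : R) : exists q : rat * rat,
      t - e < ratr q.1 < t /\ t < ratr q.2 < t + e.
    have [q /[!in_itv] q1] : exists q, ratr q \in `]t - e, t[ by apply: rat_in_itvoo; lra.
    have [q' /[!in_itv] q2] : exists q, ratr q \in `]t, t + e[ by apply: rat_in_itvoo; lra.
    by exists (q, q').
  have [q1 [/andP[a1 a2] /andP[a3 a4]]] := rat_near x.1.
  have [q2 [/andP[b1 b2] /andP[b3 b4]]] := rat_near x.2.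
  exists (q1, q2) => //; rewrite /B.
  case: asboolP => [_|]; first by split; rewrite /= in_itv/=; apply/andP.
  case=> y [/=]; rewrite !in_itv/= => /andP[c1 c2] /andP[c3 c4].
  apply: eA; split; rewrite /ball/= ltr_norml; apply/andP; split; lra.
apply: countable_bigcupT_measurable => [|q]; first exact: countableP.
rewrite /B; case: ifP => // _.
by apply: measurableX; exact: measurable_itv.
Qed.

Lemma continuous_measurable_plane {R : realType} (f : R * R -> R) :
  continuous f ->
  measurable_fun setT (f : measurableTypeR R * measurableTypeR R -> R).
Proof.
move=> /continuousP cf; apply: (measurability _ (measurable_realfun.RGenOpens.measurableE R)).
move=> _ [_ [a [b ->] <-]]; rewrite setTI; apply: open_measurable_plane.
exact/cf/interval_open.
Qed.

Local Notation lebesgue2 R := (@lebesgue_measure R \x @lebesgue_measure R)%E.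

Lemma compact_sub_square {R : realType} (K : set (R * R)) : compact K ->
  exists2 M : R, 0 < M & K `<=` `[- M, M]%classic `*` `[- M, M]%classic.
Proof.
move=> /compact_bounded[M [_ KM]].
exists (`|M| + 1); first by rewrite ltr_wpDl.
move=> x Kx; have : `|x| <= `|M| + 1.
  by apply: KM => //; rewrite (le_lt_trans (ler_norm M))// ltrDl.
rewrite prod_normE ge_max => /andP[x1 x2].
by split; rewrite /= in_itv/= -ler_norml.
Qed.

Lemma continuous_supported_bounded {R : realType} (K : set (R * R)) (f : R * R -> R) :
  compact K -> continuous f -> supported K f ->
  exists2 C : R, 0 <= C & forall x, `|f x| <= C.
Proof.
move=> cK cf sf.
have /compact_bounded[M [_ KM]] : compact (f @` K).
  by apply: continuous_compact => //; exact: continuous_subspaceT.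
exists (`|M| + 1) => [|x]; first by rewrite addr_ge0.
have [Kx|/sf ->] := pselect (K x); last by rewrite normr0 addr_ge0.
by apply: KM; [rewrite (le_lt_trans (ler_norm M))// ltrDl|exists x].
Qed.

Lemma integrable_supported {R : realType} (K : set (R * R)) (f : R * R -> R) :
  compact K -> continuous f -> supported K f ->
  (lebesgue2 R).-integrable setT (EFin \o f).
Proof.
move=> cK cf sf.
have [M M0 KM] := compact_sub_square K cK.
have [C C0 fC] := continuous_supported_bounded K f cK cf sf.
pose Q : set (measurableTypeR R * measurableTypeR R) :=
  `[- M, M]%classic `*` `[- M, M]%classic.
have mQ : measurable Q by apply: measurableX; exact: measurable_itv.
have -> : EFin \o f = (EFin \o f) \_ Q.
  apply/funext => x; rewrite patchE; case: ifPn => // /negP xQ /=.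
  by rewrite sf// => /KM Qx; apply: xQ; rewrite inE.
apply: (iffLR (integrable_mkcond _ mQ)).
pose J := `[- M, M]%classic : set R.
have QE : lebesgue2 R Q = (lebesgue_measure J * lebesgue_measure J)%E.
  by apply: product_measure1E; exact: measurable_itv.
have Qfin : (lebesgue2 R Q < +oo)%E.
  rewrite QE /J lebesgue_measure_itv/=.
  by case: ifP => _; rewrite -?EFinB -?EFinM ?mul0e ltry.
apply: (@measurable_bounded_integrable _ _ _ _ _ _ mQ Qfin).
- by apply: measurable_funTS; exact: continuous_measurable_plane.
- exists C; split; first exact: num_real.
  by move=> y Cy x _; rewrite /= (le_trans (fC x))// ltW.
Qed.

(** The fundamental theorem of calculus between two points beyond the support. *)
Lemma integral_derivative_eq0 {R : realType} (h h' : R -> R) (M : R) :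
  (forall t : R, is_derive t (1 : R) h (h' t)) -> continuous h' ->
  (forall t, M < `|t| -> h t = 0 /\ h' t = 0) ->
  (\int[lebesgue_measure]_t (h' t)%:E = 0)%E.
Proof.
move=> dh ch hM.
(* The endpoint [|M| + 1] is positive and lies strictly beyond [M] whatever the sign of [M]. *)
pose D : set R := `[- (`|M| + 1), `|M| + 1]%classic.
have MM : M < `|M| + 1 by rewrite (le_lt_trans (ler_norm M))// ltrDl.
have M0 : 0 < `|M| + 1 by rewrite ltr_wpDl.
have -> : (fun t => (h' t)%:E) = (EFin \o h') \_ D.
  apply/funext => t; rewrite patchE; case: ifPn => // /negP tD.
  rewrite (hM _ _).2// ltNge; apply/negP => tM; apply: tD.
  by rewrite inE /D/= in_itv/= -ler_norml (le_trans tM)// ltW.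
rewrite -integral_mkcond /D.
have ch1 (t : R) : {for t, continuous h}.
  by case: (dh t) => /derivable1_diffP/differentiable_continuous.
rewrite (@continuous_FTC2 _ h' h) ?gtrN//.
- have hb : h (`|M| + 1) = 0 by apply: (hM _ _).1; rewrite ger0_norm// ltW.
  have ha : h (- (`|M| + 1)) = 0 by apply: (hM _ _).1; rewrite normrN ger0_norm// ltW.
  by rewrite ha hb subee.
- exact: continuous_subspaceT.
- split=> [t _||]; first by case: (dh t).
    by apply: cvg_at_right_filter; exact: ch1.
  by apply: cvg_at_left_filter; exact: ch1.
- by move=> t _; rewrite derive1E; exact: (@derive_val _ _ _ _ _ _ _ (dh t)).
Qed.

(** Estimates are made over the whole plane, for integrands vanishing off a compact set; integrals
    over [Omega] are compared with these in [L1norm_le] and [L1norm_ge]. *)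
Definition int2 {R : realType} (f : R * R -> R) : R := \int[lebesgue2 R]_x f x.

(** By Fubini, integrating first in the variable of differentiation: each inner integral is that of
    the derivative of a compactly supported function on the line. *)
Lemma int2_partial {R : realType} (K : set (R * R)) (f : R * R -> R) j :
  compact K -> supported K f -> smooth f -> int2 (partial j f) = 0.
Proof.
move=> cK sK sf.
have sK' := supported_partial K f j (compact_closed_plane cK) sK.
have cf' := smooth_continuous (smooth_partial j sf).
have int_f := integrable_supported K _ cK cf' sK'.
have [M M0 KM] := compact_sub_square K cK.
have out (x : R * R) : M < `|x.1| \/ M < `|x.2| -> ~ K x.
  move=> xM /KM[/=]; rewrite !in_itv/= -!ler_norml => x1 x2.
  by case: xM; rewrite ltNge ?x1 ?x2.
rewrite /int2 /Rintegral.
have [j0|j1] := eqVneq j ord0.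
  rewrite -(integral21_prod_meas1 int_f) /fubini_G.
  rewrite integral0_eq// => y _ /=.
  apply: (@integral_derivative_eq0 _ (fun t => f (t, y)) (fun t => partial j f (t, y)) M).
  - move=> t; have := smooth_derivable sf j (t, y).
    rewrite /partial /derivable /derive => d.
    have E : (fun h => h^-1 *: (f (h *: basis2 j + (t, y)) - f (t, y))) =
             (fun h => h^-1 *: (f (h *: (1 : R) + t, y) - f (t, y))).
      apply/funext => h; rewrite /basis2 j0 eqxx.
      by congr (_ *: (f _ - _)); congr pair; rewrite /= scaler0 add0r.
    by split; [move: d|]; rewrite /derivable /derive E.
  - move=> t; have c1 : {for t, continuous (fun t : R => (t, y))}.
      move=> A [[B1 B2] [/= nB1 nB2] BA]; apply: filterS nB1 => s B1s.
      by apply: BA; split=> //; exact: nbhs_singleton nB2.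
    exact: (continuous_comp c1 (cf' _)).
  - by move=> t tM; split; [apply: sK|apply: sK']; apply: out; left.
have {}j1 : j = ord_max by apply: val_inj; move: j j1 {sK' cf' int_f}; case; case=> [|[|]].
rewrite -(integral12_prod_meas1 int_f) /fubini_F.
rewrite integral0_eq// => y _ /=.
apply: (@integral_derivative_eq0 _ (fun t => f (y, t)) (fun t => partial j f (y, t)) M).
- move=> t; have := smooth_derivable sf j (y, t).
  rewrite /partial /derivable /derive => d.
  have E : (fun h => h^-1 *: (f (h *: basis2 j + (y, t)) - f (y, t))) =
           (fun h => h^-1 *: (f (y, h *: (1 : R) + t) - f (y, t))).
    apply/funext => h; rewrite /basis2 j1 /=.
    by congr (_ *: (f _ - _)); congr pair; rewrite /= scaler0 add0r.
  by split; [move: d|]; rewrite /derivable /derive E.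
- move=> t; have c1 : {for t, continuous (fun t : R => (y, t))}.
    move=> A [[B1 B2] [/= nB1 nB2] BA]; apply: filterS nB2 => s B2s.
    by apply: BA; split=> //; exact: nbhs_singleton nB1.
  exact: (continuous_comp c1 (cf' _)).
- by move=> t tM; split; [apply: sK|apply: sK']; apply: out; right.
Qed.

(** Absolute values destroy smoothness, so integrals are manipulated in this larger class, which
    still guarantees integrability when [K] is compact. *)
Definition test_function {R : realType} (K : set (R * R)) (f : R * R -> R) : Prop :=
  continuous f /\ supported K f.

Lemma test_functionD {R : realType} (K : set (R * R)) (f g : R * R -> R) :
  test_function K f -> test_function K g -> test_function K (fun x => f x + g x).
Proof.
move=> [cf sf] [cg sg]; split=> [x|x Kx]; first exact: (cvgD (cf x) (cg x)).
by rewrite sf// sg// addr0.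
Qed.

Lemma test_functionM {R : realType} (K : set (R * R)) (f g : R * R -> R) :
  test_function K f -> continuous g -> test_function K (fun x => f x * g x).
Proof.
move=> [cf sf] cg; split=> [x|x Kx]; first exact: (cvgM (cf x) (cg x)).
by rewrite sf// mul0r.
Qed.

Lemma test_functionZ {R : realType} (K : set (R * R)) (c : R) (f : R * R -> R) :
  test_function K f -> test_function K (fun x => c * f x).
Proof.
move=> [cf sf]; split=> [x|x Kx]; first exact: (cvgM (cvg_cst c) (cf x)).
by rewrite sf// mulr0.
Qed.

Lemma test_function_norm {R : realType} (K : set (R * R)) (f : R * R -> R) :
  test_function K f -> test_function K (fun x => `|f x|).
Proof.
move=> [cf sf]; split=> [x|x Kx]; last by rewrite sf// normr0.
exact: (cvg_norm (cf x)).
Qed.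

Lemma test_function_integrable {R : realType} (K : set (R * R)) (f : R * R -> R) :
  compact K -> test_function K f -> (lebesgue2 R).-integrable setT (EFin \o f).
Proof. by move=> cK [cf sf]; exact: integrable_supported cK cf sf. Qed.

Lemma int2D {R : realType} (K : set (R * R)) (f g : R * R -> R) : compact K ->
  test_function K f -> test_function K g ->
  int2 (fun x => f x + g x) = int2 f + int2 g.
Proof.
by move=> cK tf tg; apply: RintegralD => //; exact: test_function_integrable cK _.
Qed.

Lemma int2Z {R : realType} (K : set (R * R)) (c : R) (f : R * R -> R) :
  compact K -> test_function K f -> int2 (fun x => c * f x) = c * int2 f.
Proof.
by move=> cK tf; apply: RintegralZl => //; exact: test_function_integrable cK _.
Qed.

Lemma int2_le {R : realType} (K : set (R * R)) (f g : R * R -> R) : compact K ->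
  test_function K f -> test_function K g -> (forall x, f x <= g x) ->
  int2 f <= int2 g.
Proof.
move=> cK tf tg fg.
by apply: le_Rintegral => //; exact: test_function_integrable cK _.
Qed.

Lemma int2_ge0 {R : realType} (f : R * R -> R) :
  (forall x, 0 <= f x) -> 0 <= int2 f.
Proof. by move=> f0; exact: Rintegral_ge0. Qed.

Lemma int2_norm {R : realType} (K : set (R * R)) (f : R * R -> R) : compact K ->
  test_function K f -> `|int2 f| <= int2 (fun x => `|f x|).
Proof.
by move=> cK tf; apply: le_normr_Rintegral => //; exact: test_function_integrable cK _.
Qed.

(** By continuity [f] exceeds [f p / 2] on an open square about [p], whose area is positive. *)
Lemma int2_gt0 {R : realType} (K : set (R * R)) (f : R * R -> R) p : compact K ->
  test_function K f -> (forall x, 0 <= f x) -> 0 < f p -> 0 < int2 f.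
Proof.
move=> cK [cf sf] f0 fp.
pose c := f p / 2.
have c0 : 0 < c by rewrite divr_gt0.
have : \near p, c < f p.
  have : nbhs (f p) [set t | c < t] by apply: lt_nbhsr; rewrite /c; move: fp; lra.
  exact: cf.
move=> /nbhs_ballP[e /= e0 eE].
pose J1 : set R := `]p.1 - e, p.1 + e[%classic.
pose J2 : set R := `]p.2 - e, p.2 + e[%classic.
pose Q : set (measurableTypeR R * measurableTypeR R) := J1 `*` J2.
have mQ : measurable Q by apply: measurableX; exact: measurable_itv.
have QE : lebesgue2 R Q = (lebesgue_measure J1 * lebesgue_measure J2)%E.
  by apply: product_measure1E; exact: measurable_itv.
have Q0 : lebesgue2 R Q = ((2 * e) ^+ 2)%:E.
  rewrite QE /J1 /J2 !lebesgue_measure_itv/= !lte_fin.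
  have -> : p.1 - e < p.1 + e by lra.
  have -> : p.2 - e < p.2 + e by lra.
  by rewrite -!EFinB -EFinM; congr EFin; ring.
have fQ x : Q x -> c <= f x.
  rewrite /Q /J1 /J2 => -[/=]; rewrite !in_itv/= => /andP[a1 a2] /andP[b1 b2].
  apply: ltW; apply: eE; split; rewrite /ball/= ltr_norml; apply/andP; split; lra.
have int_f := integrable_supported K f cK cf sf.
have int_lt : (\int[lebesgue2 R]_x (f x)%:E)%E \is a fin_num.
  exact: (integrable_fin_num _ int_f).
rewrite /int2 /Rintegral -lte_fin fineK//.
have mf := measurable_int _ int_f.
apply: (@lt_le_trans _ _ (\int[lebesgue2 R]_(x in Q) (f x)%:E)%E); last first.
  by apply: ge0_subset_integral => // x _; rewrite lee_fin.
apply: (@lt_le_trans _ _ (\int[lebesgue2 R]_(x in Q) (cst c%:E) x)%E).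
  rewrite integral_cst//.
  apply: (@lt_le_trans _ _ (c%:E * ((2 * e) ^+ 2)%:E)%E); last by rewrite -Q0.
  by rewrite -EFinM lte_fin mulr_gt0// exprn_gt0// mulr_gt0.
apply: ge0_le_integral => //.
- by move=> x _; rewrite lee_fin ltW.
- exact: measurable_funS mf.
Qed.

Lemma smooth_test {R : realType} (K : set (R * R)) (f : R * R -> R) :
  smooth f -> supported K f -> test_function K f.
Proof. by move=> sf sK; split=> //; exact: smooth_continuous. Qed.

Lemma supportedM {R : realType} (K : set (R * R)) (f g : R * R -> R) :
  supported K f -> supported K (fun x => f x * g x).
Proof. by move=> sf x /sf ->; rewrite mul0r. Qed.

Definition phase {R : realType} (v : 'I_2 -> R) (N : R) : R * R -> R :=
  affine (fun j => N * v j) 0.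

(** Integration by parts in a variable with [v_j] nonzero: the [j]-th derivative of
    [g psi0(N v . x)] has integral [0], hence [N v_j] times the integral of [g psi] equals minus
    that of [(partial j g) psi0], which is bounded in [N]. *)
Lemma riemann_lebesgue {R : realType} (K : set (R * R)) (g : R * R -> R)
    (v : 'I_2 -> R) j (psi0 psi : R -> R) (eta : R) :
  compact K -> supported K g -> smooth g -> v j != 0 ->
  (forall x : R, is_derive x (1 : R) psi0 (psi x)) ->
  (forall x, `|psi0 x| <= 1) ->
  (forall N, smooth (psi0 \o phase v N)) -> (forall N, continuous (psi \o phase v N)) ->
  0 < eta ->
  \forall N \near +oo, `|int2 (fun x => g x * psi (phase v N x))| <= eta.
Proof.
move=> cK sg smg vj dpsi psi1 spsi cpsi eta0.
have tg : test_function K (partial j g).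
  apply: smooth_test; first exact: smooth_partial.
  exact: supported_partial (compact_closed_plane cK) _.
pose C := int2 (fun x => `|partial j g x|).
have C0 : 0 <= C by apply: int2_ge0.
exists (C / (eta * `|v j|)); split=> [|N NC]; first exact: num_real.
have v0 : 0 < `|v j| by rewrite normr_gt0.
have N0 : 0 < N by apply: le_lt_trans NC; rewrite divr_ge0// mulr_ge0// ltW.
have := int2_partial K (fun x => g x * (psi0 \o phase v N) x) j cK
  (supportedM _ _ _ sg) (smoothM _ _ smg (spsi N)).
rewrite (partialM _ _ _ smg (spsi N)) (partial_affine_comp _ _ _ _ _ dpsi).
have t1 : test_function K (fun x => partial j g x * (psi0 \o phase v N) x).
  by apply: test_functionM => //; exact: smooth_continuous (spsi N).
have t2 : test_function K (fun x => g x * psi (phase v N x)).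
  by apply: (test_functionM _ _ _ (smooth_test _ _ smg sg)); exact: cpsi.
have E : (fun x => g x * (N * v j * psi (affine (fun j0 => N * v j0) 0 x))) =
    (fun x => (N * v j) * (g x * psi (phase v N x))).
  by apply/funext => x; rewrite /phase; ring.
rewrite (int2D _ _ _ cK t1); last by rewrite E; exact: test_functionZ.
rewrite E (int2Z _ _ _ cK t2) => /eqP; rewrite addrC addr_eq0 => /eqP H.
have : `|N * v j * int2 (fun x => g x * psi (phase v N x))| <= C.
  rewrite H normrN (le_trans (int2_norm _ _ cK t1))//.
  apply: (int2_le _ _ _ cK).
  - exact: test_function_norm.
  - exact: test_function_norm.
  - by move=> x; rewrite normrM ler_piMr//; exact: psi1.
rewrite !normrM (gtr0_norm N0) => H2.
have NV : 0 < N * `|v j| by rewrite mulr_gt0.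
rewrite -(ler_pM2l NV) (le_trans H2)//.
move: NC; rewrite ltr_pdivrMr ?mulr_gt0// => /ltW.
by rewrite -mulrA [`|v j| * _]mulrC.
Qed.

(** * Fast oscillations *)

Lemma smooth_sin_phase {R : realType} (v : 'I_2 -> R) N : smooth (fun x => sin (phase v N x)).
Proof. exact: smooth_affine_comp smooth1_sin. Qed.

Lemma smooth_cos_phase {R : realType} (v : 'I_2 -> R) N : smooth (fun x => cos (phase v N x)).
Proof. exact: smooth_affine_comp smooth1_cos. Qed.

Lemma near_int2_sin {R : realType} (K : set (R * R)) (g : R * R -> R)
    (v : 'I_2 -> R) j (eta : R) :
  compact K -> supported K g -> smooth g -> v j != 0 -> 0 < eta ->
  \forall N \near +oo, `|int2 (fun x => g x * sin (phase v N x))| <= eta.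
Proof.
move=> cK sK sg vj eta0.
apply: (riemann_lebesgue K g v j (fun t => - cos t) sin eta cK sK sg vj _ _ _ _ eta0).
- by move=> x; apply: is_derive_eq; rewrite opprK.
- by move=> x; rewrite normrN ler_norml cos_geN1 cos_le1.
- move=> N; have -> : (fun t : R => - cos t) \o phase v N =
      (fun x => -1 * cos (phase v N x)) by apply/funext => x /=; rewrite mulN1r.
  exact/smoothZ/smooth_cos_phase.
- by move=> N; exact: smooth_continuous (smooth_sin_phase v N).
Qed.

(** The function [sin^2 - 1/2] has the bounded primitive [- (sin cos) / 2], so [riemann_lebesgue]
    applies to it. *)
Lemma near_int2_sin2 {R : realType} (K : set (R * R)) (g : R * R -> R)
    (v : 'I_2 -> R) j (eta : R) :
  compact K -> supported K g -> smooth g -> v j != 0 -> 0 < eta ->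
  \forall N \near +oo,
    `|int2 (fun x => g x * (sin (phase v N x) * sin (phase v N x))) - int2 g / 2| <= eta.
Proof.
move=> cK sK sg vj eta0.
have : \forall N \near +oo, `|int2 (fun x => g x * (sin (phase v N x) ^+ 2 - 1 / 2))| <= eta.
  apply: (riemann_lebesgue K g v j (fun t => - 2^-1 * (sin t * cos t))
    (fun t => sin t ^+ 2 - 1 / 2) eta cK sK sg vj _ _ _ _ eta0).
  - move=> x; have H : is_derive x (1 : R) (fun t => - 2^-1 * (sin t * cos t))
        (- 2^-1 * (sin x * - sin x + cos x * cos x)).
      exact: (is_deriveZ _ (is_deriveM (is_derive_sin x) (is_derive_cos x))).
    apply: (is_derive_eq H).
    have := cos2Dsin2 x; rewrite !expr2 => e; lra.
  - move=> x; rewrite normrM normrN (ger0_norm (_ : 0 <= 2^-1 :> R)) ?invr_ge0//.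
    have : `|sin x * cos x| <= 1.
      by rewrite normrM mulr_ile1// ler_norml ?sin_geN1 ?sin_le1 ?cos_geN1 ?cos_le1.
    lra.
  - by move=> N; apply/smoothZ/smoothM; [exact: smooth_sin_phase|exact: smooth_cos_phase].
  - move=> N; have : smooth (fun x => sin (phase v N x) * sin (phase v N x) + - (1 / 2)).
      apply: smoothD; last exact: smooth_cst.
      by apply: smoothM; exact: smooth_sin_phase.
    have -> : (fun x => sin (phase v N x) * sin (phase v N x) + - (1 / 2)) =
        (fun t : R => sin t ^+ 2 - 1 / 2) \o phase v N.
      by apply/funext => x; rewrite /= expr2.
    exact: smooth_continuous.
apply: filterS => N.
have tg := smooth_test _ _ sg sK.
have -> : (fun x => g x * (sin (phase v N x) ^+ 2 - 1 / 2)) =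
    (fun x => g x * (sin (phase v N x) * sin (phase v N x)) + - (1 / 2) * g x).
  by apply/funext => x; rewrite expr2; ring.
rewrite (int2D _ _ _ cK); last 2 first.
- apply: (test_functionM _ _ _ tg).
  by apply: smooth_continuous; apply: smoothM; exact: smooth_sin_phase.
- exact: test_functionZ.
rewrite (int2Z _ _ _ cK tg); set a := int2 _; set b := int2 _.
by have -> : a + - (1 / 2) * b = a - b / 2 by lra.
Qed.

Lemma partial2_sin_phase {R : realType} (g : R * R -> R) (v : 'I_2 -> R) (N : R) i j :
  smooth g ->
  partial j (partial i (fun x => g x * sin (phase v N x))) =
  (fun x => partial j (partial i g) x * sin (phase v N x)
    + N * ((partial i g x * v j + partial j g x * v i) * cos (phase v N x))
    - N ^+ 2 * (v i * v j * (g x * sin (phase v N x)))).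
Proof.
move=> sg.
have ds k : partial k (fun x => sin (phase v N x)) = (fun x => N * v k * cos (phase v N x)).
  by apply: (partial_affine_comp sin cos) => x; exact: is_derive_sin.
have dc k : partial k (fun x => cos (phase v N x)) = (fun x => N * v k * - sin (phase v N x)).
  by apply: (partial_affine_comp cos (fun x => - sin x)) => x; exact: is_derive_cos.
have ss := smooth_sin_phase v N; have sc := smooth_cos_phase v N.
have sig := smooth_partial i sg.
rewrite (partialM _ _ _ sg ss) ds.
rewrite (partialD _ _ _ (smoothM _ _ sig ss) (smoothM _ _ sg (smoothZ _ _ sc))).
rewrite (partialM _ _ _ sig ss) ds.
have -> : (fun x => g x * (N * v i * cos (phase v N x))) =
    (fun x => (N * v i) * (g x * cos (phase v N x))).
  by apply/funext => x; ring.
rewrite (partialZ _ _ _ (smoothM _ _ sg sc)).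
rewrite (partialM _ _ _ sg sc) dc.
by apply/funext => x; ring.
Qed.

(** Of the terms of the second derivative, only the one with both derivatives on the sine has size
    [N^2]; after division by [N^2] the others are of order [1 / N]. *)
Lemma near_int2_hessian {R : realType} (K : set (R * R)) (g : R * R -> R)
    (v : 'I_2 -> R) i j (eta : R) :
  compact K -> supported K g -> smooth g -> 0 < eta ->
  \forall N \near +oo,
    int2 (fun x => `| N ^- 2 * partial j (partial i (fun x => g x * sin (phase v N x))) x
      + v i * v j * (g x * sin (phase v N x))|) <= eta.
Proof.
move=> cK sK sg eta0.
have cK' := compact_closed_plane cK.
pose B x := `|partial j (partial i g) x| +
  (`|v j| * `|partial i g x| + `|v i| * `|partial j g x|).
have tp k : test_function K (partial k g).
  by apply: smooth_test; [exact: smooth_partial|exact: supported_partial].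
have tpp : test_function K (partial j (partial i g)).
  by apply: smooth_test; [do 2 apply: smooth_partial|do 2 apply: supported_partial => //].
have tB : test_function K B.
  apply: test_functionD; first exact: test_function_norm.
  by apply: test_functionD; apply: test_functionZ; exact: test_function_norm.
(* [N > 1] gives [N^-2 <= N^-1], so that [B / N] dominates the integrand. *)
exists (Num.max 1 (int2 B / eta)); split=> [|N]; first exact: num_real.
rewrite gt_max => /andP[N1 NB].
have N0 : 0 < N by apply: lt_trans N1.
rewrite (partial2_sin_phase _ _ _ _ _ sg).
have E : (fun x => `|N ^- 2 *
    (partial j (partial i g) x * sin (phase v N x) +
     N * ((partial i g x * v j + partial j g x * v i) * cos (phase v N x)) -
     N ^+ 2 * (v i * v j * (g x * sin (phase v N x)))) +
    v i * v j * (g x * sin (phase v N x))|) =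
  (fun x => `|N ^- 2 * (partial j (partial i g) x * sin (phase v N x)) +
     N^-1 * ((partial i g x * v j + partial j g x * v i) * cos (phase v N x))|).
  apply/funext => x; congr (`| _ |); field; exact: lt0r_neq0.
rewrite E.
apply: (@le_trans _ _ (int2 (fun x => N^-1 * B x))); last first.
  rewrite (int2Z _ _ _ cK tB) mulrC ler_pdivrMr// mulrC -ler_pdivrMr//.
  exact: ltW.
apply: (int2_le _ _ _ cK).
- apply: test_function_norm; apply: test_functionD; apply: test_functionZ.
    by apply: (test_functionM _ _ _ tpp); exact: smooth_continuous (smooth_sin_phase v N).
  apply: test_functionM; last exact: smooth_continuous (smooth_cos_phase v N).
  have -> : (fun x => partial i g x * v j + partial j g x * v i) =
      (fun x => v j * partial i g x + v i * partial j g x).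
    by apply/funext => x; ring.
  by apply: test_functionD; apply: test_functionZ.
- exact: test_functionZ.
- move=> x; have V0 : 0 <= N^-1 by rewrite invr_ge0 ltW.
  have V1 : N ^- 2 <= N^-1.
    rewrite -exprVn expr2 ler_piMr// invf_le1//; exact: ltW.
  have V2 : 0 <= N ^- 2 by rewrite -exprVn exprn_ge0.
  have s1 : `|sin (phase v N x)| <= 1 by rewrite ler_norml sin_geN1 sin_le1.
  have c1 : `|cos (phase v N x)| <= 1 by rewrite ler_norml cos_geN1 cos_le1.
  rewrite /B mulrDr (le_trans (ler_normD _ _))// lerD//.
    rewrite normrM (ger0_norm V2) ler_pM// normrM ler_piMr//.
  rewrite normrM (ger0_norm V0) ler_wpM2l// normrM.
  apply: (@le_trans _ _ `|partial i g x * v j + partial j g x * v i|).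
    by rewrite ler_piMr.
  by rewrite (le_trans (ler_normD _ _))// !normrM lerD// mulrC.
Qed.

(** * Riesz products *)

(* [U], [M], [F] are the potential, the Riesz product and its transform after some
   number of steps; [R1 + i R2] is the complex product used as a test function.
   The values [x], [y], [z] are those the integrals would have if the oscillating
   factors were independent. *)
Definition riesz_state {R : realType} (chi : R * R -> R) (S D : 'M[R]_2)
    (m x y z eta : R) (U M F R1 R2 : R * R -> R) : Prop :=
  [/\ [/\ smooth U, smooth M, smooth F, smooth R1 & smooth R2],
      forall p, 0 <= M p,
      forall p, R1 p ^+ 2 + R2 p ^+ 2 <= m,
      forall i j, int2 (fun p => `|partial j (partial i (fun q => chi q * U q)) p
        - chi p * (F p / 2 * S i j + (M p - 1) / 2 * D i j)|) <= eta &
      [/\ `|int2 (fun p => chi p * M p) - 1| <= eta,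
          `|int2 (fun p => chi p * M p * R1 p) - x| <= eta,
          `|int2 (fun p => chi p * M p * R2 p) - y| <= eta &
          `|int2 (fun p => chi p * F p * R2 p) - z| <= eta]].

(** The numbers are exact and the error is arbitrary, so each step can ask its predecessor for a
    smaller error and no loss accumulates over the iteration. *)
Definition reachable {R : realType} (chi : R * R -> R) (S D : 'M[R]_2)
    (m x y z : R) : Prop :=
  forall eta, 0 < eta ->
  exists U M F R1 R2, riesz_state chi S D m x y z eta U M F R1 R2.

Lemma reachable_start {R : realType} (chi : R * R -> R) (S D : 'M[R]_2) :
  int2 chi = 1 -> reachable chi S D 1 1 0 0.
Proof.
move=> chi1 eta eta0.
have int0 : int2 (fun _ : R * R => 0 : R) = 0.
  by rewrite /int2 /Rintegral integral0_eq.
(* The empty products [M = 1] and [R = 1], with [F = 0]: the target Hessian vanishes since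
   [M - 1 = 0], so [U = 0] is exact. *)
exists (cst 0), (cst 1), (cst 0), (cst 1), (cst 0); split.
- by split; exact: smooth_cst.
- by move=> p /=; exact: ler01.
- by move=> p /=; rewrite expr1n expr0n addr0.
- move=> i j; have -> : (fun q : R * R => chi q * cst 0 q) = cst 0.
    by apply/funext => q; rewrite mulr0.
  have p0 k : partial k (cst 0 : R * R -> R) = cst 0.
    by apply/funext => q; rewrite /partial derive_cst.
  rewrite !p0.
  have -> : (fun p : R * R => `|cst 0 p - chi p *
      (cst 0 p / 2 * S i j + (cst 1 p - 1) / 2 * D i j)|) = (fun _ => 0).
    by apply/funext => q /=; rewrite subrr !mul0r addr0 mulr0 subrr normr0.
  by rewrite int0 ltW.
- have -> : (fun p : R * R => chi p * cst 1 p) = chi.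
    by apply/funext => q; rewrite mulr1.
  have -> : (fun p : R * R => chi p * cst 1 p * cst 1 p) = chi.
    by apply/funext => q; rewrite !mulr1.
  have -> : (fun p : R * R => chi p * cst 1 p * cst 0 p) = (fun _ => 0).
    by apply/funext => q; rewrite mulr0.
  have -> : (fun p : R * R => chi p * cst 0 p * cst 0 p) = (fun _ => 0).
    by apply/funext => q; rewrite mulr0.
  by rewrite chi1 int0 !subrr normr0; split; exact: ltW.
Qed.

Lemma ler_norm_lin {R : realType} (c a e l : R) : `|c| <= l -> `|a| <= e -> `|c * a| <= l * e.
Proof. by move=> cl ae; rewrite normrM ler_pM. Qed.

(* One more factor, with sign [eps]: averaging [sin] gives [0] and [sin ^ 2] gives
   [1 / 2]. The hypothesis on [v] says that [eps S + D] is the rank one matrix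
   [2 k v v^T], the Hessian direction that [k N^-2 chi M sin (N v . x)] can produce. *)
Lemma reachable_step {R : realType} (K : set (R * R)) (chi : R * R -> R)
    (S D : 'M[R]_2) (m x y z eps lam k : R) (v : 'I_2 -> R) i0 :
  compact K -> supported K chi -> smooth chi ->
  eps * eps = 1 -> `|eps| = 1 -> 0 <= lam -> v i0 != 0 ->
  (forall i j, eps * S i j + D i j = 2 * k * (v i * v j)) ->
  reachable chi S D m x y z ->
  reachable chi S D (m * (1 + lam ^+ 2)) (x - eps * lam / 2 * y)
    (y + eps * lam / 2 * x) (z + lam / 2 * x).
Proof.
move=> cK sK schi eps2 eps1 lam0 vi0 SD reach eta eta0.
(* Errors get multiplied by at most [lam] or [|k|], and only a few of them are added; the
   denominator absorbs all of this. *)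
pose eta1 := eta / (4 * (1 + lam) * (1 + `|k|)).
have k0 : 0 < 1 + `|k| by rewrite ltr_pwDl.
have l0 : 0 < 1 + lam by rewrite ltr_pwDl.
have eta10 : 0 < eta1 by rewrite divr_gt0// !mulr_gt0.
have eta1E : eta1 * (4 * (1 + lam) * (1 + `|k|)) = eta.
  by rewrite /eta1 divfK// gt_eqF// !mulr_gt0.
have [U [M [F [R1 [R2 [[sU sM sF sR1 sR2] M0 Rm hess [iM ix iy iz]]]]]]] := reach _ eta10.
have sKM (f : R * R -> R) : supported K (fun p => chi p * f p) by exact: supportedM.
have sKMM (f g : R * R -> R) : supported K (fun p => chi p * f p * g p).
  by apply: supportedM; exact: supportedM.
have scM := smoothM _ _ schi sM.
have scMR1 := smoothM _ _ scM sR1.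
have scMR2 := smoothM _ _ scM sR2.
have scF := smoothM _ _ schi sF.
have scFR1 := smoothM _ _ scF sR1.
have scFR2 := smoothM _ _ scF sR2.
(* The frequency is chosen after the previous state, whose functions enter as amplitudes below; this
   is what makes the frequencies grow fast enough. *)
near (pinfty_nbhs R) => N.
pose s p := sin (phase v N p).
have ss : smooth s := smooth_sin_phase v N.
have N_M : `|int2 (fun p => chi p * M p * s p)| <= eta1.
  by rewrite /s; near: N; exact: near_int2_sin cK _ _ vi0 eta10.
have N_MR1 : `|int2 (fun p => chi p * M p * R1 p * s p)| <= eta1.
  by rewrite /s; near: N; exact: near_int2_sin cK _ _ vi0 eta10.
have N_MR2 : `|int2 (fun p => chi p * M p * R2 p * s p)| <= eta1.
  by rewrite /s; near: N; exact: near_int2_sin cK _ _ vi0 eta10.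
have N_FR1 : `|int2 (fun p => chi p * F p * R1 p * s p)| <= eta1.
  by rewrite /s; near: N; exact: near_int2_sin cK _ _ vi0 eta10.
have N_MR1s : `|int2 (fun p => chi p * M p * R1 p * (s p * s p))
    - int2 (fun p => chi p * M p * R1 p) / 2| <= eta1.
  by rewrite /s; near: N; exact: near_int2_sin2 cK _ _ vi0 eta10.
have N_MR2s : `|int2 (fun p => chi p * M p * R2 p * (s p * s p))
    - int2 (fun p => chi p * M p * R2 p) / 2| <= eta1.
  by rewrite /s; near: N; exact: near_int2_sin2 cK _ _ vi0 eta10.
have N_hess : forall i j, int2 (fun p => `| N ^- 2 *
    partial j (partial i (fun q => chi q * M q * s q)) p
    + v i * v j * (chi p * M p * s p)|) <= eta1.
  rewrite /s; near: N; apply: filter_forall => i; apply: filter_forall => j.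
  exact: near_int2_hessian cK _ _ eta10.
have s1 p : `|s p| <= 1 by rewrite ler_norml sin_geN1 sin_le1.
have t1 (f : R * R -> R) : smooth f -> supported K f -> test_function K f.
  exact: smooth_test.
have ts (f : R * R -> R) : smooth f -> supported K f -> test_function K (fun p => f p * s p).
  by move=> sf skf; apply: t1; [exact: smoothM|exact: supportedM].
have tss (f : R * R -> R) : smooth f -> supported K f ->
    test_function K (fun p => f p * (s p * s p)).
  move=> sf skf; apply: t1; last exact: supportedM.
  exact: (smoothM _ _ sf (smoothM _ _ ss ss)).
have el : `|eps * lam| <= lam by rewrite normrM eps1 mul1r ger0_norm.
have lamE : lam * eta1 + eta1 <= eta / 4.
  have -> : eta / 4 = (1 + lam) * eta1 * (1 + `|k|) by rewrite -eta1E; field.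
  have -> : lam * eta1 + eta1 = (1 + lam) * eta1 by ring.
  by rewrite ler_peMr ?lerDl// mulr_ge0// ltW.
have kE : `|k| * eta1 + eta1 <= eta.
  have -> : eta = (1 + `|k|) * eta1 * (4 * (1 + lam)) by rewrite -eta1E; ring.
  have -> : `|k| * eta1 + eta1 = (1 + `|k|) * eta1 by ring.
  have L1 : 1 <= 4 * (1 + lam) by lra.
  have L0 : 0 <= (1 + `|k|) * eta1 by rewrite mulr_ge0// ltW.
  by rewrite ler_peMr.
have le0 : 0 <= lam * eta1 by rewrite mulr_ge0// ltW.
(* [M] is multiplied by [1 + s] and [R1 + i R2] by [1 + i eps lam s]. The term added to [U], once
   multiplied by [chi], has Hessian close to [k chi M s v v^T = chi M s (eps S + D) / 2], exactly
   what the increments of [F] and [M] require. *)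
exists (fun p => U p + - (k * N ^- 2) * (M p * s p)),
  (fun p => M p + M p * s p), (fun p => F p + eps * (M p * s p)),
  (fun p => R1 p + - (eps * lam) * (R2 p * s p)),
  (fun p => R2 p + eps * lam * (R1 p * s p)).
split.
- split.
  + exact: (smoothD _ _ sU (smoothZ _ _ (smoothM _ _ sM ss))).
  + exact: (smoothD _ _ sM (smoothM _ _ sM ss)).
  + exact: (smoothD _ _ sF (smoothZ _ _ (smoothM _ _ sM ss))).
  + exact: (smoothD _ _ sR1 (smoothZ _ _ (smoothM _ _ sR2 ss))).
  + exact: (smoothD _ _ sR2 (smoothZ _ _ (smoothM _ _ sR1 ss))).
- move=> p; have := s1 p; rewrite ler_norml => /andP[sp _].
  have -> : M p + M p * s p = M p * (1 + s p) by ring.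
  by rewrite mulr_ge0//; lra.
- move=> p.
  (* The squared modulus of [R1 + i R2] is multiplied by [1 + lam^2 s^2]. *)
  have -> : (R1 p + - (eps * lam) * (R2 p * s p)) ^+ 2 +
    (R2 p + eps * lam * (R1 p * s p)) ^+ 2 =
    (R1 p ^+ 2 + R2 p ^+ 2) * (1 + (eps * eps) * lam ^+ 2 * s p ^+ 2) by ring.
  rewrite eps2 mul1r ler_pM//.
  + by rewrite addr_ge0// sqr_ge0.
  + by rewrite addr_ge0// mulr_ge0// sqr_ge0.
  + rewrite lerD2l ler_piMr ?sqr_ge0//.
    by rewrite -[s p ^+ 2]real_normK ?num_real// expr_le1.
- move=> i j.
  have sg := smoothM _ _ scM ss.
  have -> : (fun q => chi q * (U q + - (k * N ^- 2) * (M q * s q))) =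
      (fun q => chi q * U q + - (k * N ^- 2) * (chi q * M q * s q)).
    by apply/funext => q; ring.
  have scU := smoothM _ _ schi sU.
  have sgi := smooth_partial i sg.
  rewrite (partialD _ _ _ scU (smoothZ _ _ sg)) (partialZ _ _ _ sg).
  rewrite (partialD _ _ _ (smooth_partial i scU) (smoothZ _ _ sgi)) (partialZ _ _ _ sgi).
  pose E1 p := partial j (partial i (fun q => chi q * U q)) p
        - chi p * (F p / 2 * S i j + (M p - 1) / 2 * D i j).
  pose E2 p := N ^- 2 * partial j (partial i (fun q => chi q * M q * s q)) p
    + v i * v j * (chi p * M p * s p).
  (* The new error is the old one minus [k] times the one controlled by [near_int2_hessian]; the
     rank one hypothesis [SD] cancels the remaining terms. *)
  have E p : partial j (partial i (fun q => chi q * U q)) p +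
      - (k * N ^- 2) * partial j (partial i (fun q => chi q * M q * s q)) p -
      chi p * ((F p + eps * (M p * s p)) / 2 * S i j + (M p + M p * s p - 1) / 2 * D i j)
      = E1 p - k * E2 p.
    have := SD i j; rewrite /E1 /E2.
    set P1 := partial _ _ _; set P2 := partial _ _ _; set n2 := N ^- 2.
    move=> /(congr1 (fun t => chi p * M p * s p / 2 * t)) H.
    have -> : k * (n2 * P2 + v i * v j * (chi p * M p * s p)) =
      k * n2 * P2 + chi p * M p * s p / 2 * (2 * k * (v i * v j)) by field.
    by rewrite -H; field.
  have tH (f : R * R -> R) : smooth f -> supported K f ->
      test_function K (partial j (partial i f)).
    move=> sf skf; have cK' := compact_closed_plane cK.
    apply: smooth_test; first by do 2 apply: smooth_partial.
    by do 2 apply: (supported_partial _ _ _ cK').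
  have tE1 : test_function K E1.
    apply: test_functionD; first exact: tH.
    have -> : (fun p => - (chi p * (F p / 2 * S i j + (M p - 1) / 2 * D i j))) =
       (fun p => chi p * ((- (S i j / 2)) * F p + (- (D i j / 2)) * (M p + -1))).
      by apply/funext => p; field.
    apply: t1; last exact: sKM.
    exact: (smoothM _ _ schi (smoothD _ _ (smoothZ _ _ sF)
      (smoothZ _ _ (smoothD _ _ sM (smooth_cst _))))).
  have tE2 : test_function K E2.
    apply: test_functionD; apply: test_functionZ; first exact: tH.
    exact: ts.
  apply: (@le_trans _ _ (int2 (fun p => `|E1 p| + `|k| * `|E2 p|))).
    apply: (int2_le _ _ _ cK).
    + under eq_fun do rewrite E.
      apply: test_function_norm; apply: test_functionD => //.
      under eq_fun do rewrite -mulNr.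
      exact: test_functionZ.
    + apply: test_functionD; first exact: test_function_norm.
      by apply: test_functionZ; exact: test_function_norm.
    + by move=> p; rewrite E (le_trans (ler_normB _ _))// normrM.
  rewrite (int2D _ _ _ cK (test_function_norm _ _ tE1)); last first.
    by apply: test_functionZ; exact: test_function_norm.
  rewrite (int2Z _ _ _ cK (test_function_norm _ _ tE2)).
  apply: le_trans kE; rewrite addrC lerD//; last exact: hess.
  by rewrite ler_wpM2l//; exact: N_hess.
- split.
  + have -> : (fun p => chi p * (M p + M p * s p)) =
        (fun p => chi p * M p + chi p * M p * s p) by apply/funext => p; ring.
    rewrite (int2D _ _ _ cK (t1 _ scM (sKM _)) (ts _ scM (sKM _))).
    move: iM N_M; rewrite !ler_norml => /andP[a1 a2] /andP[a3 a4].
    clear - a1 a2 a3 a4 lamE le0 eta10.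
    by apply/andP; split; lra.
  + have -> : (fun p => chi p * (M p + M p * s p) * (R1 p + - (eps * lam) * (R2 p * s p))) =
      (fun p => (chi p * M p * R1 p + chi p * M p * R1 p * s p) +
        - (eps * lam) * (chi p * M p * R2 p * s p + chi p * M p * R2 p * (s p * s p))).
      by apply/funext => p; ring.
    have T1 := t1 _ scMR1 (sKMM _ _). have T2 := ts _ scMR1 (sKMM _ _).
    have T3 := ts _ scMR2 (sKMM _ _). have T4 := tss _ scMR2 (sKMM _ _).
    rewrite (int2D _ _ _ cK (test_functionD _ _ _ T1 T2)
      (test_functionZ _ _ _ (test_functionD _ _ _ T3 T4))).
    rewrite (int2Z _ _ _ cK (test_functionD _ _ _ T3 T4)).
    rewrite (int2D _ _ _ cK T1 T2) (int2D _ _ _ cK T3 T4).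
    have B1 := ler_norm_lin _ _ _ _ el N_MR2.
    have B2 := ler_norm_lin _ _ _ _ el N_MR2s.
    have B3 := ler_norm_lin _ _ _ _ el iy.
    move: ix N_MR1 B1 B2 B3; rewrite !ler_norml.
    move=> /andP[a1 a2] /andP[a3 a4] /andP[a5 a6] /andP[a7 a8] /andP[a9 a10].
    clear - a1 a2 a3 a4 a5 a6 a7 a8 a9 a10 lamE le0 eta10.
    by apply/andP; split; lra.
  + have -> : (fun p => chi p * (M p + M p * s p) * (R2 p + eps * lam * (R1 p * s p))) =
      (fun p => (chi p * M p * R2 p + chi p * M p * R2 p * s p) +
        eps * lam * (chi p * M p * R1 p * s p + chi p * M p * R1 p * (s p * s p))).
      by apply/funext => p; ring.
    have T1 := t1 _ scMR2 (sKMM _ _). have T2 := ts _ scMR2 (sKMM _ _).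
    have T3 := ts _ scMR1 (sKMM _ _). have T4 := tss _ scMR1 (sKMM _ _).
    rewrite (int2D _ _ _ cK (test_functionD _ _ _ T1 T2)
      (test_functionZ _ _ _ (test_functionD _ _ _ T3 T4))).
    rewrite (int2Z _ _ _ cK (test_functionD _ _ _ T3 T4)).
    rewrite (int2D _ _ _ cK T1 T2) (int2D _ _ _ cK T3 T4).
    have B1 := ler_norm_lin _ _ _ _ el N_MR1.
    have B2 := ler_norm_lin _ _ _ _ el N_MR1s.
    have B3 := ler_norm_lin _ _ _ _ el ix.
    move: iy N_MR2 B1 B2 B3; rewrite !ler_norml.
    move=> /andP[a1 a2] /andP[a3 a4] /andP[a5 a6] /andP[a7 a8] /andP[a9 a10].
    clear - a1 a2 a3 a4 a5 a6 a7 a8 a9 a10 lamE le0 eta10.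
    by apply/andP; split; lra.
  + have -> : (fun p => chi p * (F p + eps * (M p * s p)) *
        (R2 p + eps * lam * (R1 p * s p))) =
      (fun p => (chi p * F p * R2 p + eps * lam * (chi p * F p * R1 p * s p)) +
        (eps * (chi p * M p * R2 p * s p) + lam * (chi p * M p * R1 p * (s p * s p)))).
      (* The sign in [F] meets the sign in [R2], and [eps * eps = 1]: the increment of [z] is the
         same for both signs, so nothing cancels. *)
      apply/funext => p; rewrite -[in lam * _](mul1r lam) -eps2; ring.
    have T1 := t1 _ scFR2 (sKMM _ _). have T2 := ts _ scFR1 (sKMM _ _).
    have T3 := ts _ scMR2 (sKMM _ _). have T4 := tss _ scMR1 (sKMM _ _).
    rewrite (int2D _ _ _ cK (test_functionD _ _ _ T1 (test_functionZ _ _ _ T2))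
      (test_functionD _ _ _ (test_functionZ _ _ _ T3) (test_functionZ _ _ _ T4))).
    rewrite (int2D _ _ _ cK T1 (test_functionZ _ _ _ T2)).
    rewrite (int2D _ _ _ cK (test_functionZ _ _ _ T3) (test_functionZ _ _ _ T4)).
    rewrite (int2Z _ _ _ cK T2) (int2Z _ _ _ cK T3) (int2Z _ _ _ cK T4).
    have le1 : `|eps| <= 1 by rewrite eps1.
    have ll : `|lam| <= lam by rewrite ger0_norm.
    have B1 := ler_norm_lin _ _ _ _ el N_FR1.
    have B2 := ler_norm_lin _ _ _ _ le1 N_MR2.
    have B3 := ler_norm_lin _ _ _ _ ll N_MR1s.
    have B4 := ler_norm_lin _ _ _ _ ll ix.
    move: iz B1 B2 B3 B4; rewrite !ler_norml.
    move=> /andP[a1 a2] /andP[a3 a4] /andP[a5 a6] /andP[a7 a8] /andP[a9 a10].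
    clear - a1 a2 a3 a4 a5 a6 a7 a8 a9 a10 lamE le0 eta10.
    by apply/andP; split; lra.
Unshelve. all: by end_near. Qed.

(* Alternating the signs keeps [R1 + i R2] real on average: [y] returns to [0]. *)
Lemma reachable_iter {R : realType} (K : set (R * R)) (chi : R * R -> R)
    (S D : 'M[R]_2) (lam a b : R) (v w : 'I_2 -> R) i0 j0 n :
  compact K -> supported K chi -> smooth chi -> int2 chi = 1 ->
  0 <= lam -> v i0 != 0 -> w j0 != 0 ->
  (forall i j, S i j = a * (v i * v j) + b * (w i * w j)) ->
  (forall i j, D i j = a * (v i * v j) - b * (w i * w j)) ->
  exists x z, [/\ 1 <= x, n%:R * lam <= z &
    reachable chi S D ((1 + lam ^+ 2) ^+ (n * 2)) x 0 z].
Proof.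
move=> cK sK schi chi1 lam0 vi0 wj0 SE DE; elim: n => [|n [x [z [x1 zn r]]]].
  exists 1, 0; split=> //; first by rewrite mul0r.
  by rewrite mul0n expr0; exact: reachable_start.
have H1 i j : 1 * S i j + D i j = 2 * a * (v i * v j) by rewrite SE DE; ring.
have H2 i j : -1 * S i j + D i j = 2 * (- b) * (w i * w j) by rewrite SE DE; ring.
have r1 := reachable_step K chi S D _ _ _ _ _ _ _ _ _ cK sK schi (mulr1 1)
  (normr1 _) lam0 vi0 H1 r.
have m2 : (-1) * (-1) = 1 :> R by rewrite mulrNN mulr1.
have n1 : `|-1 : R| = 1 by rewrite normrN1.
have r2 := reachable_step K chi S D _ _ _ _ _ _ _ _ _ cK sK schi m2 n1 lam0 wj0 H2 r1.
(* A step along [v] with sign [1] and [k = a], then one along [w] with sign [-1] and [k = -b]. The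
   pair multiplies [x] by [1 + lam^2 / 4], so [x >= 1] persists, and adds [lam x >= lam] to [z]. *)
exists (x + lam ^+ 2 / 4 * x), (z + lam * x); split.
- have : 0 <= lam ^+ 2 / 4 * x by rewrite mulr_ge0 ?divr_ge0 ?sqr_ge0// (le_trans ler01).
  lra.
- rewrite -natr1 mulrDl mul1r lerD// ler_peMr//.
- have -> : (1 + lam ^+ 2) ^+ (n.+1 * 2) =
      (1 + lam ^+ 2) ^+ (n * 2) * (1 + lam ^+ 2) * (1 + lam ^+ 2).
    by rewrite mulSn addnC exprD expr2 mulrA.
  have e1 : x - 1 * lam / 2 * 0 - -1 * lam / 2 * (0 + 1 * lam / 2 * x) =
      x + lam ^+ 2 / 4 * x by field.
  have e2 : 0 + 1 * lam / 2 * x + -1 * lam / 2 * (x - 1 * lam / 2 * 0) = 0 by field.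
  have e3 : z + lam / 2 * x + lam / 2 * (x - 1 * lam / 2 * 0) = z + lam * x by field.
  by rewrite e1 e2 e3 in r2.
Qed.

(** * Linear algebra and norms *)

Lemma euclid_norm_ge {R : realType} d (v : 'rV[R]_d) i : `|v ord0 i| <= euclid_norm v.
Proof.
rewrite /euclid_norm -sqrtr_sqr ler_wsqrtr// (bigD1 i)//= lerDl.
by apply: sumr_ge0 => j _; exact: sqr_ge0.
Qed.

Lemma euclid_norm_le_sum {R : realType} d (v : 'rV[R]_d) :
  euclid_norm v <= \sum_i `|v ord0 i|.
Proof.
have s0 : 0 <= \sum_i `|v ord0 i| by apply: sumr_ge0.
rewrite /euclid_norm -[leRHS]ger0_norm// -sqrtr_sqr ler_wsqrtr//.
rewrite [leRHS]expr2 mulr_suml ler_sum// => i _.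
rewrite -[v _ _ ^+ 2]real_normK ?num_real// expr2 ler_wpM2l//.
by rewrite (bigD1 i)//= lerDl sumr_ge0.
Qed.

Lemma continuous_euclid_norm {R : realType} d (g : R * R -> 'rV[R]_d) :
  (forall i, continuous (fun x => g x ord0 i)) -> continuous (fun x => euclid_norm (g x)).
Proof.
move=> cg x.
have cs : continuous (fun x => \sum_i g x ord0 i ^+ 2).
  apply: continuous_big => [|i _ y]; first exact: add_continuous.
  exact: (cvgM (cg i y) (cg i y)).
exact: (continuous_comp (cs x) (@sqrt_continuous R _)).
Qed.

Lemma test_function_sum {R : realType} (I : finType) (K : set (R * R))
    (f : I -> R * R -> R) :
  (forall i, test_function K (f i)) -> test_function K (fun x => \sum_i f i x).
Proof.
move=> tf; split=> [|x Kx]; last first.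
  by rewrite big1// => i _; exact: (tf i).2.
apply: continuous_big => [|i _]; first exact: add_continuous.
exact: (tf i).1.
Qed.

Lemma int2_sum {R : realType} (I : finType) (K : set (R * R)) (f : I -> R * R -> R) :
  compact K -> (forall i, test_function K (f i)) ->
  int2 (fun x => \sum_i f i x) = \sum_i int2 (f i).
Proof.
move=> cK tf.
have H (r : seq I) : test_function K (fun x => \sum_(i <- r) f i x) /\
    int2 (fun x => \sum_(i <- r) f i x) = \sum_(i <- r) int2 (f i).
  elim: r => [|i r [IH1 IH2]].
    under eq_fun do rewrite big_nil; rewrite big_nil; split.
      by split=> // x; exact: cvg_cst.
    by rewrite /int2 /Rintegral integral0_eq.
  under eq_fun do rewrite big_cons; rewrite big_cons -IH2; split.
    exact: test_functionD.
  exact: int2D cK _ _.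
exact: (H _).2.
Qed.

Lemma int2_EFin {R : realType} (K : set (R * R)) (f : R * R -> R) :
  compact K -> test_function K f ->
  (\int[lebesgue2 R]_x (f x)%:E)%E = (int2 f)%:E.
Proof.
move=> cK tf; rewrite /int2 /Rintegral fineK//.
exact: (integrable_fin_num _ (test_function_integrable _ _ cK tf)).
Qed.

Lemma L1norm_le {R : realType} d (Omega K : set (R * R)) (g : R * R -> 'rV[R]_d)
    (h : R * R -> R) :
  open Omega -> compact K -> (forall i, continuous (fun x => g x ord0 i)) ->
  test_function K h -> (forall x, euclid_norm (g x) <= h x) ->
  (L1norm Omega g <= (int2 h)%:E)%E.
Proof.
move=> oO cK cg th gh.
have mO := open_measurable_plane _ oO.
have mh := measurable_int _ (test_function_integrable _ _ cK th).
have g0 x : 0 <= euclid_norm (g x) by exact: sqrtr_ge0.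
have h0 x : 0 <= h x by exact: le_trans (gh x).
rewrite -(int2_EFin _ _ cK th) /L1norm.
apply: (@le_trans _ _ (\int[lebesgue2 R]_(x in Omega) (h x)%:E)%E); last first.
  by apply: ge0_subset_integral => // x _; rewrite lee_fin.
apply: ge0_le_integral => //.
- by move=> x _; rewrite lee_fin.
- apply/measurable_realfun.measurable_EFinP; apply: measurable_funTS.
  exact: continuous_measurable_plane (continuous_euclid_norm _ _ cg).
- exact: measurable_funS mh.
- by move=> x _; rewrite lee_fin.
Qed.

Lemma L1norm_ge {R : realType} d (Omega K : set (R * R)) (g : R * R -> 'rV[R]_d)
    (h : R * R -> R) :
  open Omega -> compact K -> K `<=` Omega ->
  (forall i, continuous (fun x => g x ord0 i)) ->
  test_function K h -> (forall x, 0 <= h x) -> (forall x, h x <= euclid_norm (g x)) ->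
  ((int2 h)%:E <= L1norm Omega g)%E.
Proof.
move=> oO cK KO cg th h0 hg.
have mO := open_measurable_plane _ oO.
have mh := measurable_int _ (test_function_integrable _ _ cK th).
have g0 x : 0 <= euclid_norm (g x) by exact: sqrtr_ge0.
rewrite -(int2_EFin _ _ cK th) /L1norm.
have -> : (fun x => (h x)%:E) = (EFin \o h) \_ Omega.
  apply/funext => x; rewrite patchE; case: ifPn => // /negP xO.
  by rewrite th.2// => /KO Ox; apply: xO; rewrite inE.
rewrite -integral_mkcond.
apply: ge0_le_integral => //.
- by move=> x _; rewrite lee_fin.
- exact: measurable_funS mh.
- apply/measurable_realfun.measurable_EFinP; apply: measurable_funTS.
  exact: continuous_measurable_plane (continuous_euclid_norm _ _ cg).
- by move=> x _; rewrite lee_fin.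
Qed.

Lemma linear_bound {R : realType} d (P : {linear 'M[R]_2 -> 'rV[R]_d}) :
  exists2 c : R, 0 <= c &
    forall X, \sum_k `|P X ord0 k| <= c * \sum_i \sum_j `|X i j|.
Proof.
exists (\sum_k \sum_i \sum_j `|P (delta_mx i j) ord0 k|) => [|X].
  by do 3 (apply: sumr_ge0 => ? _).
rewrite mulr_suml ler_sum// => k _.
rewrite {1}(matrix_sum_delta X) linear_sum summxE (le_trans (ler_norm_sum _ _ _))//.
rewrite mulr_suml ler_sum// => i _.
rewrite linear_sum summxE (le_trans (ler_norm_sum _ _ _))//.
rewrite mulr_suml ler_sum// => j _.
rewrite linearZ mxE normrM mulrC ler_wpM2l//.
rewrite (bigD1 i)//= (bigD1 j)//= -addrA lerDl addr_ge0//.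
  by apply: sumr_ge0.
by do 2 (apply: sumr_ge0 => ? _).
Qed.

(** In matrix form [T] is the pseudo-inverse of [B2] followed by [B1]. A row [X] and
    [X B2 pinvmx(B2)] have the same image under [B2], so their difference is killed by [B2] and
    hence by [B1]. *)
Lemma linear_factor {R : realType} m n d1 d2 (P1 : {linear 'M[R]_(m, n) -> 'rV[R]_d1})
    (P2 : {linear 'M[R]_(m, n) -> 'rV[R]_d2}) :
  (forall A, P2 A = 0 -> P1 A = 0) ->
  exists T : {linear 'rV[R]_d2 -> 'rV[R]_d1}, forall A, P1 A = T (P2 A).
Proof.
move=> ker; pose B1 := lin1_mx (P1 \o vec_mx); pose B2 := lin1_mx (P2 \o vec_mx).
have E1 A : P1 A = mxvec A *m B1 by rewrite mul_rV_lin1 /= mxvecK.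
have E2 A : P2 A = mxvec A *m B2 by rewrite mul_rV_lin1 /= mxvecK.
exists (mulmxr (pinvmx B2 *m B1)) => A /=.
have : P2 (vec_mx (mxvec A - mxvec A *m B2 *m pinvmx B2)) = 0.
  by rewrite E2 vec_mxK mulmxBl mulmxKpV ?submxMl// subrr.
move=> /ker; rewrite !E1 E2 vec_mxK mulmxBl => /eqP; rewrite subr_eq0 => /eqP ->.
by rewrite !mulmxA.
Qed.

(** Completing the square suffices, as [v] and [w] need not be orthogonal. The coefficients may
    vanish, but both vectors must be nonzero to serve as directions of oscillation. *)
Lemma symmetric_diagonalize {R : realType} (S : 'M[R]_2) : S^T = S ->
  exists a b (v w : 'I_2 -> R) i0 j0, [/\ v i0 != 0, w j0 != 0 &
    forall i j, S i j = a * (v i * v j) + b * (w i * w j)].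
Proof.
move=> ST.
have S10 : S ord_max ord0 = S ord0 ord_max by rewrite -[in LHS]ST mxE.
have ex (a b : R) v0 v1 w0 w1 (v := fun i : 'I_2 => if i == ord0 then v0 else v1 : R)
    (w := fun i : 'I_2 => if i == ord0 then w0 else w1 : R) i0 j0 :
    v i0 != 0 -> w j0 != 0 ->
    S ord0 ord0 = a * (v0 * v0) + b * (w0 * w0) ->
    S ord0 ord_max = a * (v0 * v1) + b * (w0 * w1) ->
    S ord_max ord_max = a * (v1 * v1) + b * (w1 * w1) ->
    exists a b (v w : 'I_2 -> R) i0 j0, [/\ v i0 != 0, w j0 != 0 &
    forall i j, S i j = a * (v i * v j) + b * (w i * w j)].
  move=> hv hw e1 e2 e3; exists a, b, v, w, i0, j0; split=> // i j.
  have I2 (k : 'I_2) : k = ord0 \/ k = ord_max.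
    by case: k => -[|[|//]] k; [left|right]; exact: val_inj.
  rewrite /v /w.
  by have [->|->] := I2 i; have [->|->] := I2 j; rewrite /= ?S10 ?e1 ?e2 ?e3//; ring.
set p := S ord0 ord0 in ex; set q := S ord0 ord_max in ex; set r := S ord_max ord_max in ex.
have [p0|p0] := eqVneq p 0; last first.
  apply: (ex p (r - q * q / p) 1 (q / p) 0 1 ord0 ord_max) => //=; try exact: oner_neq0.
  - by rewrite -/p; ring.
  - by rewrite -/q; field.
  - by rewrite -/r; field.
have [r0|r0] := eqVneq r 0; last first.
  apply: (ex (p - q * q / r) r 1 0 (q / r) 1 ord0 ord_max) => //=; try exact: oner_neq0.
  - by rewrite -/p; field.
  - by rewrite -/q; field.
  - by rewrite -/r; ring.
(* With a zero diagonal no square can be completed; polarization along [(1, 1)] and [(1, -1)] is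
   used instead. *)
apply: (ex (q / 2) (- (q / 2)) 1 1 1 (-1) ord0 ord0) => //=; try exact: oner_neq0.
- by rewrite -/p p0; ring.
- by rewrite -/q; field.
- by rewrite -/r r0; ring.
Qed.

(** * The two bounds *)

Lemma smooth_grad {R : realType} (u : R * R -> R) : smooth u -> smooth (grad u).
Proof.
move=> su; apply: (@smooth_rV _ 1 (grad u)) => i.
have -> : (fun x => grad u x ord0 i) = partial i u by apply/funext => x; rewrite mxE.
exact: smooth_partial.
Qed.

Lemma Jac_grad {R : realType} (u : R * R -> R) x : smooth u ->
  Jac (grad u) x = \matrix_(i, j) partial j (partial i u) x.
Proof.
move=> su; apply/matrixP => i j; rewrite !mxE.
rewrite (@partial_coord _ 1 _ i j x (smooth_grad _ su)).
by congr (partial j _ x); apply/funext => y; rewrite mxE.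
Qed.

Lemma test_function_linear {R : realType} d (K : set (R * R))
    (P : {linear 'M[R]_2 -> 'rV[R]_d}) (A : R * R -> 'M[R]_2) k :
  (forall i j, test_function K (fun x => A x i j)) ->
  test_function K (fun x => P (A x) ord0 k).
Proof.
move=> tA.
have -> : (fun x => P (A x) ord0 k) =
    (fun x => \sum_i \sum_j P (delta_mx i j) ord0 k * A x i j).
  apply/funext => x; rewrite [in LHS](matrix_sum_delta (A x)) linear_sum summxE.
  apply: eq_bigr => i _; rewrite linear_sum summxE.
  by apply: eq_bigr => j _; rewrite linearZ mxE mulrC.
by do 2 apply: test_function_sum => ?; exact: test_functionZ.
Qed.

Definition hessian_error {R : realType} (chi : R * R -> R) (S D : 'M[R]_2)
    (U M F : R * R -> R) (p : R * R) : 'M[R]_2 :=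
  \matrix_(i, j) (partial j (partial i (fun q => chi q * U q)) p
        - chi p * (F p / 2 * S i j + (M p - 1) / 2 * D i j)).

Lemma Jac_grad_error {R : realType} (chi : R * R -> R) (S D : 'M[R]_2)
    (U M F : R * R -> R) p : smooth (fun q => chi q * U q) ->
  Jac (grad (fun q => chi q * U q)) p = (chi p * F p / 2) *: S +
    (chi p * (M p - 1) / 2) *: D + hessian_error chi S D U M F p.
Proof.
by move=> su; rewrite Jac_grad//; apply/matrixP => i j; rewrite !mxE; ring.
Qed.

Lemma test_function_hessian {R : realType} (K : set (R * R)) (u : R * R -> R) i j :
  compact K -> smooth u -> supported K u -> test_function K (partial j (partial i u)).
Proof.
move=> cK su sK; have cK' := compact_closed_plane cK.
apply: smooth_test; first by do 2 apply: smooth_partial.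
by do 2 apply: (supported_partial _ _ _ cK').
Qed.

Lemma test_function_hessian_error {R : realType} (K : set (R * R)) (chi : R * R -> R)
    (S D : 'M[R]_2) (U M F : R * R -> R) i j :
  compact K -> supported K chi -> smooth chi -> smooth U -> smooth M -> smooth F ->
  test_function K (fun p => hessian_error chi S D U M F p i j).
Proof.
move=> cK sK schi sU sM sF.
have -> : (fun p => hessian_error chi S D U M F p i j) =
  (fun p => partial j (partial i (fun q => chi q * U q)) p +
    chi p * ((- (S i j / 2)) * F p + (- (D i j / 2)) * (M p + -1))).
  by apply/funext => p; rewrite mxE; field.
apply: test_functionD.
  exact: test_function_hessian cK (smoothM _ _ schi sU) (supportedM _ _ _ sK).
apply: smooth_test; last exact: supportedM.
exact: (smoothM _ _ schi (smoothD _ _ (smoothZ _ _ sF)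
  (smoothZ _ _ (smoothD _ _ sM (smooth_cst _))))).
Qed.

Lemma int2_hessian_error {R : realType} (K : set (R * R)) (chi : R * R -> R)
    (S D : 'M[R]_2) (m x y z eta : R) (U M F R1 R2 : R * R -> R) :
  compact K -> supported K chi -> smooth chi ->
  riesz_state chi S D m x y z eta U M F R1 R2 ->
  int2 (fun p => \sum_i \sum_j `|hessian_error chi S D U M F p i j|) <= 4 * eta.
Proof.
move=> cK sK schi [[sU sM sF sR1 sR2] _ _ hess _].
have tE i j := test_function_norm _ _
  (test_function_hessian_error K chi S D U M F i j cK sK schi sU sM sF).
rewrite (int2_sum _ _ _ cK); last by move=> i; apply: test_function_sum => j; exact: tE.
have H i : int2 (fun p => \sum_j `|hessian_error chi S D U M F p i j|) <= 2 * eta.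
  rewrite (int2_sum _ _ _ cK (tE i)) !big_ord_recl big_ord0 addr0.
  have H j : int2 (fun p => `|hessian_error chi S D U M F p i j|) <= eta.
    by under eq_fun do rewrite mxE; exact: hess.
  by have := lerD (H ord0) (H (lift ord0 ord0)); lra.
rewrite !big_ord_recl big_ord0 addr0.
by have := lerD (H ord0) (H (lift ord0 ord0)); lra.
Qed.

(** As [P S = 0], the part with [F] disappears; what remains is controlled by the integrals of
    [chi M] and [chi] and by the Hessian error. The bound does not depend on the number of factors,
    and error [1] in the state is enough. *)
Lemma riesz_upper {R : realType} d (P : {linear 'M[R]_2 -> 'rV[R]_d}) (Omega K : set (R * R))
    (chi : R * R -> R) (S D : 'M[R]_2) :
  open Omega -> compact K -> supported K chi -> smooth chi -> (forall x, 0 <= chi x) ->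
  int2 chi = 1 -> P S = 0 ->
  exists2 B, 0 <= B & forall (m x y z : R) (U M F R1 R2 : R * R -> R),
    riesz_state chi S D m x y z 1 U M F R1 R2 ->
    (L1norm Omega (first_order_op P (grad (fun q => chi q * U q)%R)) <= B%:E)%E.
Proof.
move=> oO cK sK schi chi0 chi1 PS.
have [c c0 Pc] := linear_bound _ P.
pose q := \sum_k `|P D ord0 k|.
have q0 : 0 <= q by exact: sumr_ge0.
(* [3 / 2] is half of [2 + 1], from the integrals of [chi M] (at most [2]) and of [chi]; [4] counts
   the entries of the error matrix. *)
exists (3 / 2 * q + 4 * c) => [|m x y z U M F R1 R2 st].
  by rewrite addr_ge0 ?mulr_ge0.
have [[sU sM sF sR1 sR2] M0 Rm hess [iM ix iy iz]] := st.
have su := smoothM _ _ schi sU.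
have tE i j := test_function_hessian_error K chi S D U M F i j cK sK schi sU sM sF.
pose W p := \sum_i \sum_j `|hessian_error chi S D U M F p i j|.
have tW : test_function K W.
  by do 2 apply: test_function_sum => ?; exact: test_function_norm.
have tchi := smooth_test _ _ schi sK.
have tM := smooth_test _ _ (smoothM _ _ schi sM) (supportedM _ _ M sK).
pose h p := (q / 2 * (chi p * M p) + q / 2 * chi p) + c * W p.
have th1 := test_functionD _ _ _ (test_functionZ _ (q / 2) _ tM)
  (test_functionZ _ (q / 2) _ tchi).
have th : test_function K h := test_functionD _ _ _ th1 (test_functionZ _ c _ tW).
have cH k : continuous (fun x => first_order_op P (grad (fun q => chi q * U q)) x ord0 k).
  rewrite /first_order_op; apply: (proj1 (test_function_linear _ K _ _ _ _)) => i j.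
  under eq_fun do rewrite Jac_grad// mxE.
  exact: test_function_hessian cK su (supportedM _ _ _ sK).
apply: (le_trans (L1norm_le _ _ _ _ h oO cK cH th _)).
  move=> p; rewrite /first_order_op (Jac_grad_error _ S D _ M F)//.
  rewrite !linearD !linearZ /= PS scaler0 add0r.
  rewrite (le_trans (euclid_norm_le_sum _ _))//.
  apply: (@le_trans _ _ (\sum_k (chi p * (M p + 1) / 2 * `|P D ord0 k| +
      `|P (hessian_error chi S D U M F p) ord0 k|))).
    apply: ler_sum => k _; rewrite !mxE (le_trans (ler_normD _ _))// lerD2r.
    rewrite normrM ler_wpM2r// !normrM (ger0_norm (chi0 p)).
    rewrite (ger0_norm (_ : 0 <= 2^-1 :> R)) ?invr_ge0//.
    rewrite ler_wpM2r ?invr_ge0// ler_wpM2l//.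
    by rewrite (le_trans (ler_normB _ _))// normr1 ger0_norm.
  rewrite big_split /= -mulr_sumr -/q /h lerD//.
  have -> : chi p * (M p + 1) / 2 * q = q / 2 * (chi p * M p) + q / 2 * chi p by ring.
  exact: lexx.
rewrite lee_fin /h (int2D _ _ _ cK th1 (test_functionZ _ _ _ tW)) (int2Z _ _ _ cK tW).
rewrite (int2D _ _ _ cK (test_functionZ _ (q / 2) _ tM) (test_functionZ _ (q / 2) _ tchi)).
rewrite (int2Z _ _ _ cK tM) (int2Z _ _ _ cK tchi) chi1.
apply: lerD.
  have iM2 : int2 (fun p => chi p * M p) <= 2 by move: iM; rewrite ler_norml => /andP[_]; lra.
  have := ler_wpM2l (_ : 0 <= q / 2) iM2; rewrite divr_ge0// => /(_ isT); lra.
have := int2_hessian_error _ _ _ _ _ _ _ _ _ _ _ _ _ _ cK sK schi st.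
by rewrite mulr1 mulrC => /(ler_wpM2r c0); rewrite mulrC.
Qed.

(** By duality: the [k]-th component is paired with [R2], which is bounded by [r]. The part with [F]
    contributes [z] up to an error, and all other parts pair to at most a constant multiple of [r],
    independent of the number of factors. *)
Lemma riesz_lower {R : realType} d (P : {linear 'M[R]_2 -> 'rV[R]_d}) (Omega K : set (R * R))
    (chi : R * R -> R) (S D : 'M[R]_2) (k : 'I_d) (r : R) :
  open Omega -> compact K -> K `<=` Omega -> supported K chi -> smooth chi ->
  (forall x, 0 <= chi x) -> int2 chi = 1 -> 0 <= r ->
  exists B, forall (m x y z : R) (U M F R1 R2 : R * R -> R),
    m <= r ^+ 2 -> riesz_state chi S D m x y z 1 U M F R1 R2 ->
    exists2 h, `|P S ord0 k| / 2 * (z - 1) <= r * h + B &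
      (h%:E <= L1norm Omega (first_order_op P (grad (fun q => chi q * U q)%R)))%E.
Proof.
move=> oO cK KO sK schi chi0 chi1 r0.
have [c c0 Pc] := linear_bound _ P.
set p0 := P S ord0 k; pose q0 := P D ord0 k.
exists (r * (3 / 2 * `|q0| + 4 * c)) => m x y z U M F R1 R2 mr st.
have [[sU sM sF sR1 sR2] M0 Rm hess [iM ix iy iz]] := st.
have su := smoothM _ _ schi sU.
have tE i j := test_function_hessian_error K chi S D U M F i j cK sK schi sU sM sF.
pose W p := \sum_i \sum_j `|hessian_error chi S D U M F p i j|.
have tW : test_function K W.
  by do 2 apply: test_function_sum => ?; exact: test_function_norm.
have R2r p : `|R2 p| <= r.
  rewrite -(ger0_norm r0) -ler_sqr ?nnegrE// !real_normK ?num_real//.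
  by rewrite (le_trans _ mr)// (le_trans _ (Rm p))// lerDr sqr_ge0.
have cR2 := smooth_continuous sR2.
have tH j : test_function K
    (fun x => first_order_op P (grad (fun q => chi q * U q)) x ord0 j).
  rewrite /first_order_op; apply: test_function_linear => a b.
  under eq_fun do rewrite Jac_grad// mxE.
  exact: test_function_hessian cK su (supportedM _ _ _ sK).
pose f p := first_order_op P (grad (fun q => chi q * U q)) p ord0 k.
have tf : test_function K f := tH k.
exists (int2 (fun p => `|f p|)); last first.
  apply: (L1norm_ge _ _ K _ _ oO cK KO) => [i|||p] //; first exact: (tH i).1.
    exact: test_function_norm.
  exact: euclid_norm_ge.
pose e p := P (hessian_error chi S D U M F p) ord0 k.
have te : test_function K e by exact: test_function_linear.
have fE p : f p * R2 p = (p0 / 2 * (chi p * F p * R2 p) + q0 / 2 * (chi p * M p * R2 p))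
    + (- (q0 / 2) * (chi p * R2 p) + e p * R2 p).
  have -> : f p = chi p * F p / 2 * p0 + chi p * (M p - 1) / 2 * q0 + e p.
    by rewrite /f /first_order_op (Jac_grad_error _ S D _ M F)// !linearD !linearZ !mxE.
  by ring.
have tchi := smooth_test _ _ schi sK.
have tM := smooth_test _ _ (smoothM _ _ schi sM) (supportedM _ _ M sK).
have tF := smooth_test _ _ (smoothM _ _ schi sF) (supportedM _ _ F sK).
have t1 := test_functionM _ _ _ tF cR2.
have t2 := test_functionM _ _ _ tM cR2.
have t3 := test_functionM _ _ _ tchi cR2.
have t4 := test_functionM _ _ _ te cR2.
have tz1 := test_functionZ _ (p0 / 2) _ t1.
have tz2 := test_functionZ _ (q0 / 2) _ t2.
have tz3 := test_functionZ _ (- (q0 / 2)) _ t3.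
have bound g : test_function K g ->
    `|int2 (fun p => g p * R2 p)| <= r * int2 (fun p => `|g p|).
  move=> tg; have tgR := test_functionM _ _ _ tg cR2.
  rewrite (le_trans (int2_norm _ _ cK tgR))// -(int2Z _ _ _ cK (test_function_norm _ _ tg)).
  apply: (int2_le _ _ _ cK (test_function_norm _ _ tgR)
    (test_functionZ _ _ _ (test_function_norm _ _ tg))) => p.
  by rewrite normrM mulrC ler_wpM2r.
have b2 := bound _ tM. have b3 := bound _ tchi. have b4 := bound _ te. have bf := bound _ tf.
have E : int2 (fun p => f p * R2 p) = (p0 / 2 * int2 (fun p => chi p * F p * R2 p) +
    q0 / 2 * int2 (fun p => chi p * M p * R2 p)) +
    (- (q0 / 2) * int2 (fun p => chi p * R2 p) + int2 (fun p => e p * R2 p)).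
  under [in LHS]eq_fun do rewrite fE.
  rewrite (int2D _ _ _ cK (test_functionD _ _ _ tz1 tz2) (test_functionD _ _ _ tz3 t4)).
  by rewrite (int2D _ _ _ cK tz1 tz2) (int2D _ _ _ cK tz3 t4)
    (int2Z _ _ _ cK t1) (int2Z _ _ _ cK t2) (int2Z _ _ _ cK t3).
have nM : int2 (fun p => `|chi p * M p|) <= 2.
  have -> : (fun p => `|chi p * M p|) = (fun p => chi p * M p).
    by apply/funext => p; rewrite ger0_norm// mulr_ge0.
  by move: iM; rewrite ler_norml => /andP[_]; lra.
have nchi : int2 (fun p => `|chi p|) = 1.
  by rewrite -chi1; congr int2; apply/funext => p; rewrite ger0_norm.
have ne : int2 (fun p => `|e p|) <= c * 4.
  apply: (@le_trans _ _ (c * int2 W)); last first.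
    rewrite ler_wpM2l//.
    by have := int2_hessian_error _ _ _ _ _ _ _ _ _ _ _ _ _ _ cK sK schi st; rewrite mulr1.
  rewrite -(int2Z _ _ _ cK tW).
  apply: (int2_le _ _ _ cK (test_function_norm _ _ te) (test_functionZ _ _ _ tW)) => p.
  by rewrite (le_trans _ (Pc _))// (bigD1 k)//= lerDl sumr_ge0.
set a1 := int2 (fun p => chi p * F p * R2 p) in iz E.
set a2 := int2 (fun p => chi p * M p * R2 p) in b2 E.
set a3 := int2 (fun p => chi p * R2 p) in b3 E.
set a4 := int2 (fun p => e p * R2 p) in b4 E.
set a5 := int2 (fun p => f p * R2 p) in bf E.
set hh := int2 (fun p => `|f p|) in bf *.
have a2r : `|a2| <= r * 2 by rewrite (le_trans b2)// ler_wpM2l.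
have a3r : `|a3| <= r by rewrite (le_trans b3)// nchi mulr1.
have a4r : `|a4| <= r * (c * 4) by rewrite (le_trans b4)// ler_wpM2l.
have z1 : z - 1 <= `|a1|.
  have := ler_norm a1; move: iz; rewrite ler_norml => /andP[]; lra.
have H : `|p0 / 2 * a1| <= `|a5| + (`|q0| / 2 * `|a2| + `|q0| / 2 * `|a3| + `|a4|).
  (* [E] solved for the pairing with [F]. *)
  have -> : p0 / 2 * a1 = a5 - (q0 / 2 * a2 + (- (q0 / 2)) * a3 + a4) by rewrite E; ring.
  rewrite (le_trans (ler_normB _ _))// lerD2l (le_trans (ler_normD _ _))// lerD2r.
  rewrite (le_trans (ler_normD _ _))// !normrM !normrN normrM.
  by rewrite (ger0_norm (_ : 0 <= 2^-1 :> R)) ?invr_ge0.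
have p20 : 0 <= `|p0| / 2 by rewrite divr_ge0.
have q20 : 0 <= `|q0| / 2 by rewrite divr_ge0.
have H1 := ler_wpM2l p20 z1.
have H2 := ler_wpM2l q20 a2r.
have H3 := ler_wpM2l q20 a3r.
have H4 : `|p0 / 2 * a1| = `|p0| / 2 * `|a1|.
  by rewrite !normrM (ger0_norm (_ : 0 <= 2^-1 :> R)) ?invr_ge0.
rewrite H4 in H.
have -> : r * hh + r * (3 / 2 * `|q0| + 4 * c) =
  r * hh + (`|q0| / 2 * (r * 2) + `|q0| / 2 * r + r * (c * 4)) by field.
lra.
Qed.

(** * Ornstein's non-inequality *)

Lemma exists_normalized_bump {R : realType} (Omega : set (R * R)) :
  open Omega -> Omega !=set0 ->
  exists K (chi : R * R -> R),
    [/\ compact K, K `<=` Omega, supported K chi, smooth chi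
      & (forall x, 0 <= chi x) /\ int2 chi = 1].
Proof.
move=> oO On; have [K [chi [p [cK KO sK schi [chi0 chip]]]]] := exists_bump _ oO On.
have tchi := smooth_test _ _ schi sK.
have i0 := int2_gt0 _ _ _ cK tchi chi0 chip.
exists K, (fun x => (int2 chi)^-1 * chi x); split.
- exact: cK.
- exact: KO.
- by move=> x /sK ->; rewrite mulr0.
- exact: smoothZ.
- split; first by move=> x; rewrite mulr_ge0// invr_ge0 ltW.
  by rewrite (int2Z _ _ _ cK tchi) mulVf// gt_eqF.
Qed.

(** If a component of [P1 S] were nonzero, [riesz_lower] would make the left norms grow linearly in
    [n], while [riesz_upper] keeps the right ones bounded. *)
Lemma ornstein_symmetric {R : realType} (Omega : set (R * R)) d1 d2
    (P1 : {linear 'M[R]_2 -> 'rV[R]_d1}) (P2 : {linear 'M[R]_2 -> 'rV[R]_d2}) (S : 'M[R]_2) :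
  open Omega -> Omega !=set0 -> S^T = S -> P2 S = 0 ->
  (exists C : R, forall u : R * R -> R, Cc_infty Omega u ->
      (L1norm Omega (first_order_op P1 (grad u))
         <= C%:E * L1norm Omega (first_order_op P2 (grad u)))%E) ->
  P1 S = 0.
Proof.
move=> oO On ST P2S [C HC].
have [K [chi [cK KO sK schi [chi0 chi1]]]] := exists_normalized_bump _ oO On.
have [a [b [v [w [i0 [j0 [vi0 wj0 SE]]]]]]] := symmetric_diagonalize _ ST.
pose D : 'M[R]_2 := \matrix_(i, j) (a * (v i * v j) - b * (w i * w j)).
have DE i j : D i j = a * (v i * v j) - b * (w i * w j) by rewrite mxE.
apply/rowP => k; rewrite [RHS]mxE; apply/eqP/negPn/negP => p0.
pose r : R := expR 1; have r0 : 0 <= r by exact: expR_ge0.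
have [B2 B20 up] := riesz_upper _ P2 Omega K chi S D oO cK sK schi chi0 chi1 P2S.
have [B1 low] := riesz_lower _ P1 Omega K chi S D k r oO cK KO sK schi chi0 chi1 r0.
pose p := `|P1 S ord0 k| / 2.
have p_gt0 : 0 < p by rewrite divr_gt0// normr_gt0.
have main n : p * (n.+1%:R - 1) <= r * (`|C| * B2) + B1.
  have l0 : 0 <= n.+1%:R^-1 :> R by rewrite invr_ge0.
  (* With [lam = 1/(n+1)] and [(n+1)^2] pairs of factors, [z >= n + 1], whereas
     [m = (1 + lam^2)^(2 (n+1)^2)] is at most [e^2], the square of [r]. *)
  have [x [z [x1 zn reach]]] := reachable_iter K chi S D n.+1%:R^-1 a b v w i0 j0
    (n.+1 ^ 2) cK sK schi chi1 l0 vi0 wj0 SE DE.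
  have nE : (n.+1 ^ 2)%:R * n.+1%:R^-1 = n.+1%:R :> R.
    by rewrite natrX expr2 mulfK// pnatr_eq0.
  rewrite nE in zn.
  have [U [M [F [R1 [R2 st]]]]] := reach 1 ltr01.
  have mr : (1 + n.+1%:R^-1 ^+ 2) ^+ (n.+1 ^ 2 * 2) <= r ^+ 2.
    rewrite exprM lerXn2r ?nnegrE ?exprn_ge0 ?addr_ge0 ?exprn_ge0//.
    apply: (@le_trans _ _ (expR (n.+1%:R^-1 ^+ 2) ^+ (n.+1 ^ 2))).
      by rewrite lerXn2r ?nnegrE ?addr_ge0 ?exprn_ge0 ?expR_ge0// expR_ge1Dx.
    rewrite -expRM_natl natrX exprVn mulfV ?expf_neq0 ?pnatr_eq0//.
  have [h hlow hL1] := low _ _ _ _ _ _ _ _ _ mr st.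
  have hup := up _ _ _ _ _ _ _ _ _ st.
  have [[sU _ _ _ _] _ _ _ _] := st.
  have Cu := Cc_infty_supported Omega K _ cK KO (supportedM _ _ U sK) (smoothM _ _ schi sU).
  have hC : h <= `|C| * B2.
    rewrite -lee_fin (le_trans hL1)// (le_trans (HC _ Cu))// EFinM.
    have L0 : (0 <= L1norm Omega (first_order_op P2 (grad (fun q => chi q * U q)%R)))%E.
      by apply: integral_ge0 => y _; rewrite lee_fin sqrtr_ge0.
    (* [C] may be negative, so it is replaced by [|C|] before the bound on the norm is inserted. *)
    apply: (@le_trans _ _ (`|C|%:E *
        L1norm Omega (first_order_op P2 (grad (fun q => chi q * U q)%R)))%E).
      by apply: lee_wpmul2r => //; rewrite lee_fin ler_norm.
    by apply: lee_wpmul2l => //; rewrite lee_fin.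
  have H1 : p * (n.+1%:R - 1) <= p * (z - 1).
    by apply: ler_wpM2l; [exact: ltW|rewrite lerD2r].
  rewrite (le_trans H1)// (le_trans hlow)// lerD2r ler_wpM2l//.
pose B := r * (`|C| * B2) + B1.
have [n nB] : exists n, B / p < n%:R.
  by exists (Num.bound `|B / p|); rewrite (le_lt_trans (ler_norm _))// archi_boundP.
have := main n; rewrite -/B -natr1 addrK.
by rewrite leNgt mulrC -ltr_pdivrMr// nB.
Qed.

(** Gradients are row vectors, so the field [A grad u] is written with [A^T] on the right. *)
Lemma Jac_grad_mul {R : realType} (A : 'M[R]_2) (u : R * R -> R) x : smooth u ->
  smooth (fun x => grad u x *m A^T) /\
  Jac (fun x => grad u x *m A^T) x = A *m Jac (grad u) x.
Proof.
move=> su.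
have E i : (fun x => (grad u x *m A^T) ord0 i) =
    (fun x => A i ord0 * partial ord0 u x + A i ord_max * partial ord_max u x).
  apply/funext => y; rewrite mxE big_ord_recl big_ord_recl big_ord0 addr0 !mxE.
  have -> : lift ord0 ord0 = ord_max :> 'I_2 by exact: val_inj.
  by rewrite ![_ * A _ _]mulrC.
have s0 := smooth_partial ord0 su; have s1 := smooth_partial ord_max su.
have sAu : smooth (fun x => grad u x *m A^T).
  apply: (@smooth_rV _ 1) => i; rewrite E.
  exact: (smoothD _ _ (smoothZ _ _ s0) (smoothZ _ _ s1)).
split=> //; rewrite Jac_grad//; apply/matrixP => i j; rewrite !mxE.
rewrite (@partial_coord _ 1 _ i j x sAu) E.
rewrite (partialD _ _ _ (smoothZ _ _ s0) (smoothZ _ _ s1)).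
rewrite (partialZ _ _ _ s0) (partialZ _ _ _ s1).
rewrite big_ord_recl big_ord_recl big_ord0 addr0 !mxE.
by have -> : lift ord0 ord0 = ord_max :> 'I_2 by exact: val_inj.
Qed.

Lemma Cc_infty_grad_mul {R : realType} (Omega : set (R * R)) (A : 'M[R]_2) (u : R * R -> R) :
  Cc_infty Omega u -> Cc_infty Omega (fun x => grad u x *m A^T).
Proof.
move=> [su cK KO]; set K := closure _ in cK KO.
apply: (Cc_infty_supported _ _ _ cK KO); last by have [] := Jac_grad_mul A u 0 su.
have sK : supported K u.
  by move=> x Kx; apply/eqP/negPn/negP => ux; apply: Kx; exact: subset_closure.
move=> x Kx; apply/rowP => i; rewrite !mxE big1// => j _.
by rewrite mxE (supported_partial _ _ _ (compact_closed_plane cK) sK)// mul0r.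
Qed.

(** On gradients the operators see only Hessians, which are symmetric, so the second factorization
    is confined to symmetric matrices: [P2 = 0] and [P1] reading off the difference of the two
    off-diagonal entries satisfy that inequality. Nonemptiness excludes the case where all the norms
    vanish. *)
Theorem theorem5 (R : realType) (Omega : set (R * R)) (d1 d2 : nat)
    (P1 : {linear 'M[R]_2 -> 'rV[R]_d1}) (P2 : {linear 'M[R]_2 -> 'rV[R]_d2}) :
  open Omega -> bounded_set Omega -> Omega !=set0 ->
  ((exists C : R, forall phi : R * R -> 'rV[R]_2, Cc_infty Omega phi ->
      (L1norm Omega (first_order_op P1 phi)
         <= C%:E * L1norm Omega (first_order_op P2 phi))%E) ->
    exists T : {linear 'rV[R]_d2 -> 'rV[R]_d1},
      forall A : 'M[R]_2, P1 A = T (P2 A))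
  /\
  ((exists C : R, forall u : R * R -> R, Cc_infty Omega u ->
      (L1norm Omega (first_order_op P1 (grad u))
         <= C%:E * L1norm Omega (first_order_op P2 (grad u)))%E) ->
    exists T : {linear 'rV[R]_d2 -> 'rV[R]_d1},
      forall A : 'M[R]_2, A^T = A -> P1 A = T (P2 A)).
Proof.
move=> oO _ On; split=> [[C HC]|HC].
  apply: linear_factor => A P2A.
  (* Composing with left multiplication by [A] makes [P1 A] and [P2 A] the values at the identity,
     which is symmetric even when [A] is not. *)
  have := @ornstein_symmetric R Omega d1 d2 (P1 \o mulmx A) (P2 \o mulmx A) 1%:M oO On.
  rewrite /= mulmx1; apply=> //; first exact: trmx1.
  exists C => u Cu; have [su _ _] := Cu.
  have E d (P : {linear 'M[R]_2 -> 'rV[R]_d}) :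
      first_order_op (P \o mulmx A) (grad u) = first_order_op P (fun x => grad u x *m A^T).
    by apply/funext => x; rewrite /first_order_op (Jac_grad_mul A u x su).2.
  by rewrite !E; apply: HC; exact: Cc_infty_grad_mul.
(* Composing with the projection onto symmetric matrices reduces the kernel condition of
   [linear_factor] to symmetric matrices, where [ornstein_symmetric] provides it. *)
pose sym (A : 'M[R]_2) := 2^-1 *: (A + A^T).
have sym_id A : A^T = A -> sym A = A.
  by move=> AT; rewrite /sym AT -mulr2n -[A *+ 2]scaler_nat scalerA mulVf ?scale1r// pnatr_eq0.
have symT A : (sym A)^T = sym A by rewrite /sym linearZ /= linearD /= trmxK addrC.
have sym_lin : linear sym.
  by move=> c A B; apply/matrixP => i j; rewrite !mxE; ring.
pose symL : {linear 'M[R]_2 -> 'M[R]_2} := HB.pack sym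
  (GRing.isLinear.Build _ _ _ _ sym sym_lin).
have [T HT] := @linear_factor R 2 2 d1 d2 (P1 \o symL) (P2 \o symL)
  (fun A h => ornstein_symmetric _ _ _ _ _ _ oO On (symT A) h HC).
by exists T => A AT; have := HT A; rewrite /= sym_id.
Qed.
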